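(* Let $r\geq k\geq 3$ be fixed integers. If a set $X\subseteq\mathbb{R}^{2r}$ of $n$ points spans $S^k_{2r}(n)-o(n^k)$ regular $(k-1)$-simplices, then one can find a partition $X=A_0\,\dot\cup\, A_1\,\dot\cup\dots\dot\cup\, A_r$ with $|A_0|=o(n)$ and $|A_i|=n/r-o(n)$ for every $i\in\{1,\dots,r\}$, and pairwise orthogonal circles $C_1,\dots,C_r\subseteq\mathbb{R}^{2r}$, such that \begin{enumerate} \item $A_i\subseteq C_i$ for all $i\in\{1,\dots,r\}$; \item $C_1,\dots,C_r$ have the same center and the same radius. \end{enumerate}
   Context: For an integer $k\geq 3$, a regular $(k-1)$-simplex is a set of $k$ points in Euclidean space whose pairwise distances are all equal. $S^k_d(n)$ denotes the maximum number of regular $(k-1)$-simplices (of any side lengths) spanned by a set of $n$ points in $\mathbb{R}^d$, where a simplex is spanned by a point set if all its vertices lie in the set. Two affine spaces are orthogonal if their associated linear spaces (direction spaces) are orthogonal. A circle is the set of all points of a $2$-dimensional affine space at some fixed distance (the radius) $\gamma>0$ from a given point (the center) of that affine space. Two circles are orthogonal if the affine spaces spanned by them are orthogonal. The $o(\cdot)$ notation is as $n\to\infty$ with $r,k$ fixed, in the usual stability sense: for every $\varepsilon>0$ there exist $\delta>0$ and $n_0$ such that if $n\geq n_0$ and $X$ spans at least $S^k_{2r}(n)-\delta n^k$ regular $(k-1)$-simplices, then the conclusion holds with $|A_0|\leq\varepsilon n$ and $\big||A_i|-n/r\big|\leq\varepsilon n$ for all $i\in\{1,\dots,r\}$. *)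

(* Defs.v *)
From HB Require Import structures.
From mathcomp Require Import all_boot all_order all_algebra.
From mathcomp Require Import finmap.
From mathcomp Require Import all_classical all_reals.
Set Implicit Arguments.
Unset Strict Implicit.
Unset Printing Implicit Defensive.
Import Order.TTheory GRing.Theory Num.Theory.
Local Open Scope fset_scope.
Local Open Scope classical_set_scope.
Local Open Scope ring_scope.

Definition edot (R : realType) (d : nat) (u v : 'rV[R]_d) : R :=
  \sum_(i < d) u 0 i * v 0 i.

(* The library norm on row vectors is the sup norm, hence this definition. *)
Definition edist (R : realType) (d : nat) (x y : 'rV[R]_d) : R :=
  Num.sqrt (edot (x - y) (x - y)).

(* A regular (k-1)-simplex, given by its set of k vertices. *)
Definition regular_simplex (R : realType) (d k : nat)
    (S : {fset 'rV[R]_d}) : Prop :=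
  #|` S| = k /\
  exists l : R, {in S &, forall x y, x != y -> edist x y = l}.

Definition simplices (R : realType) (d k : nat) (X : {fset 'rV[R]_d}) :
    {fset {fset 'rV[R]_d}} :=
  [fset S in fpowerset X | `[< regular_simplex k S >]].

(* S^k_d(n). The range of m loses nothing, since n points span at most
   'C(n, k) simplices: see max_simplices_ge and max_simplices_attained. *)
Definition max_simplices (R : realType) (d k n : nat) : nat :=
  (\max_(m < 'C(n, k).+1 |
     `[< exists X : {fset 'rV[R]_d}, #|` X| = n /\ #|` simplices k X| = m >])
     m)%N.

Lemma card_simplices_le (R : realType) (d k : nat) (X : {fset 'rV[R]_d}) :
  (#|` simplices k X| <= 'C(#|` X|, k))%N.
Proof.
pose g (A : {set X}) : {fset 'rV[R]_d} := [fsetval x in A].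
have sub : {subset simplices k X <=
    [seq g A | A <- enum [set A : {set X} | #|A| == k]%SET]}.
  move=> S; rewrite !inE /= fpowersetE => /andP[/fsubsetP SX /asboolP[Sk _]].
  have gS : g [set x : X | val x \in S]%SET = S.
    apply/fsetP => x; apply/imfsetP/idP => [[y /= + ->]|xS].
      by rewrite inE.
    by exists [` SX _ xS] => //=; rewrite inE.
  apply/mapP; exists [set x : X | val x \in S]%SET => //.
  rewrite mem_enum inE -[in X in _ == X]Sk -[in X in _ == X]gS.
  by rewrite card_imfset /= -?cardE //; apply: val_inj.
apply: leq_trans (uniq_leq_size (fset_uniq _) sub) _.
by rewrite size_map -cardE card_draws cardfE.
Qed.

Lemma max_simplices_ge (R : realType) (d k : nat) (X : {fset 'rV[R]_d}) :
  (#|` simplices k X| <= max_simplices R d k #|` X|)%N.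
Proof.
have lt_bin : (#|` simplices k X| < 'C(#|` X|, k).+1)%N.
  by rewrite ltnS card_simplices_le.
rewrite /max_simplices.
apply: (@leq_bigmax_cond _ _ (fun m : 'I_ _ => m : nat) (Ordinal lt_bin)).
by apply/asboolP; exists X.
Qed.

Lemma max_simplices_attained (R : realType) (d k : nat)
    (X : {fset 'rV[R]_d}) :
  exists2 Y : {fset 'rV[R]_d}, #|` Y| = #|` X| &
    #|` simplices k Y| = max_simplices R d k #|` X|.
Proof.
have lt_bin : (#|` simplices k X| < 'C(#|` X|, k).+1)%N.
  by rewrite ltnS card_simplices_le.
pose Q (m : 'I_('C(#|` X|, k).+1)) := `[< exists Y : {fset 'rV[R]_d},
  #|` Y| = #|` X| /\ #|` simplices k Y| = m >].
have Q_gt0 : (0 < #|Q|)%N.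
  apply/card_gt0P; exists (Ordinal lt_bin).
  by apply/asboolP; exists X.
have [m /asboolP[Y [YX Ym]] maxm] :=
  @eq_bigmax_cond _ Q (fun m => m : nat) Q_gt0.
by exists Y => //; rewrite Ym -maxm.
Qed.

Definition affine_subspace (R : realType) (d : nat) (p : 'rV[R]_d)
    (U : {vspace 'rV[R]_d}) : set 'rV[R]_d :=
  [set x | x - p \in U].

(* The intersection of all affine subspaces containing A. *)
Definition affine_span (R : realType) (d : nat) (A : set 'rV[R]_d) :
    set 'rV[R]_d :=
  [set x | forall p U, A `<=` affine_subspace p U -> affine_subspace p U x].

(* For an affine subspace A this is its direction space. *)
Definition direction (R : realType) (d : nat) (A : set 'rV[R]_d) :
    set 'rV[R]_d :=
  [set u | exists x y, [/\ A x, A y & u = x - y]].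

Definition affine_orthogonal (R : realType) (d : nat) (A B : set 'rV[R]_d) :
    Prop :=
  forall u v, direction A u -> direction B v -> edot u v = 0.

(* The circle C has center c and radius g. *)
Definition is_circle (R : realType) (d : nat) (C : set 'rV[R]_d)
    (c : 'rV[R]_d) (g : R) : Prop :=
  0 < g /\
  exists (p : 'rV[R]_d) (U : {vspace 'rV[R]_d}),
    [/\ \dim U = 2%N, affine_subspace p U c &
        C = [set x | affine_subspace p U x /\ edist x c = g]].

Definition circle_orthogonal (R : realType) (d : nat) (C D : set 'rV[R]_d) :
    Prop :=
  affine_orthogonal (affine_span C) (affine_span D).

(* Main.v *)
Require Import Defs.
From HB Require Import structures.
From mathcomp Require Import all_boot all_order all_algebra.
From mathcomp Require Import finmap.
From mathcomp Require Import all_classical all_reals.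
From mathcomp Require Import ring lra zify.
Set Implicit Arguments.
Unset Strict Implicit.
Unset Printing Implicit Defensive.
Import Order.TTheory GRing.Theory Num.Theory.
Local Open Scope fset_scope.
Local Open Scope classical_set_scope.
Local Open Scope ring_scope.

(** The points of X are taken as vertices of a graph in which two points are
    adjacent when they span equilateral triangles with a positive proportion
    of all points (rich). Every regular simplex with at least three vertices,
    apart from a negligible number, is a clique of this graph, whatever its
    side length (card_regular_not_clique). On the other hand the graph has
    few (r+1)-cliques: if they had positive density, then after fixing third
    vertices of the equilateral triangles on their edges (common_apexes),
    Erdos' theorem on complete multipartite hypergraphs (box_theorem) would
    yield r + 1 triples of points with constant distance between any two
    triples. Three points at equal distance from a further point are not
    collinear, so these triples span r + 1 planes, which are pairwise
    orthogonal, and this is impossible in dimension 2r (no_large_box).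

    The Lenz configuration shows that the density of regular k-tuples of X,
    hence of k-cliques of the graph, is almost that of the complete balanced
    r-partite graph. Together with the scarcity of (r+1)-cliques, the
    Moon-Moser inequalities for the clique densities (moon_moser) must then
    all be nearly sharp (density_stability). Therefore almost all degrees are
    close to (1 - 1/r) n, there is a positive density of r-cliques, and few
    cliques are not regular. For most r-cliques K it follows that almost
    every vertex is adjacent to exactly r - 1 entries of K and forms a regular
    simplex with these.

    Erdos' theorem, applied to these cliques, gives r triples of points with
    one common distance l between any two of them such that, for each j,
    about n/r points of X have distance l from all triples but the j-th
    (combinatorial_stability). The planes of the triples are orthogonal and
    fill the space; they can be translated to a common point c from which all
    the points just mentioned have distance l / sqrt 2 (box_circles). So X has
    about n/r points on each of r orthogonal circles around c, which are
    disjoint and thus account for almost all of X. *)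

(** * Clique densities and the Moon-Moser inequalities *)

(** The density of ordered s-cliques in the complete balanced r-partite
    graph on a large number of vertices. *)
Definition turan (R : realType) (r s : nat) : R :=
  \prod_(i < s) (1 - i%:R / r%:R).

(** What is used of the sequence of clique densities of a graph; the last
    clause is the Moon-Moser inequality. *)
Definition density_seq (R : realType) (a : nat -> R) : Prop :=
  [/\ forall s, 0 <= a s <= 1, a 0%N = 1, a 1%N = 1 &
      forall s, s.+1%:R * a s.+1 ^+ 2 <= a s * (a s.+1 + s%:R * a s.+2)].

Lemma turanS (R : realType) (r s : nat) :
  turan R r s.+1 = turan R r s * (1 - s%:R / r%:R).
Proof. by rewrite /turan big_ord_recr. Qed.

Lemma turan_factor_ge0 (R : realType) (r s : nat) :
  (0 < r)%N -> (s <= r)%N -> 0 <= 1 - s%:R / r%:R :> R.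
Proof.
move=> r0 sr; rewrite subr_ge0 ler_pdivrMr ?mul1r ?ler_nat //.
by rewrite ltr0n.
Qed.

Lemma turan_factor_le1 (R : realType) (r s : nat) :
  1 - s%:R / r%:R <= 1 :> R.
Proof. by rewrite lerBlDr lerDl divr_ge0 ?ler0n. Qed.

Lemma turan_ge0 (R : realType) (r s : nat) :
  (0 < r)%N -> (s <= r)%N -> 0 <= turan R r s.
Proof.
move=> r0 sr; apply: prodr_ge0 => i _; apply: turan_factor_ge0 => //.
exact: leq_trans (ltnW (ltn_ord i)) sr.
Qed.

Lemma turan_le1 (R : realType) (r s : nat) :
  (0 < r)%N -> (s <= r)%N -> turan R r s <= 1.
Proof.
move=> r0 sr; apply: prodr_ile1 => i _; rewrite turan_factor_le1 andbT.
apply: turan_factor_ge0 => //; exact: leq_trans (ltnW (ltn_ord i)) sr.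
Qed.

(** Downward induction on s from s = r, where the bound is the hypothesis:
    if a (s+2) is at most (1 - (s+1)/r) a (s+1) up to an error, then the
    Moon-Moser inequality is a quadratic inequality for a (s+1) which gives
    a (s+1) <= (1 - s/r) a s up to the square root of that error. *)
Lemma density_step (R : realType) (r : nat) (eta : R) :
  (0 < r)%N -> 0 < eta ->
  exists2 gamma : R, 0 < gamma & forall a : nat -> R, density_seq a ->
    a r.+1 <= gamma -> forall s, (s <= r)%N ->
    a s.+1 <= (1 - s%:R / r%:R) * a s + eta.
Proof.
move=> r0 eta0.
have r0' : 0 < r%:R :> R by rewrite ltr0n.
suff H : forall t e, 0 < e -> exists2 gamma : R, 0 < gamma &
    forall a : nat -> R, density_seq a -> a r.+1 <= gamma ->
    forall s, (s <= r)%N -> (r <= s + t)%N ->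
    a s.+1 <= (1 - s%:R / r%:R) * a s + e.
  have [g g0 Hg] := H r eta eta0; exists g => // a da ha s sr.
  by apply: Hg => //; rewrite leq_addl.
elim=> [|t IH] e e0.
  exists e => // a [_ _ _ _] ha s sr; rewrite addn0 => rs.
  have -> : s = r by apply/eqP; rewrite eqn_leq sr.
  by rewrite divff ?gt_eqF // subrr mul0r add0r.
(* the quadratic inequality turns an error of e ^+ 2 for s.+2 into e *)
have m0 : 0 < Num.min e (e ^+ 2) by rewrite lt_min e0 exprn_gt0.
have [g g0 Hg] := IH _ m0; exists g => // a da ha s sr rs.
have [le1|lt1] := leqP r (s + t).
  apply: le_trans (Hg a da ha s sr le1) _.
  by rewrite lerD2l ge_min lexx.
have srt : (s.+1 + t)%N = r by apply/eqP; rewrite eqn_leq addSn lt1 -addnS.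
have sr' : (s.+1 <= r)%N by rewrite -srt leq_addr.
have := Hg a da ha s.+1 sr'; rewrite srt leqnn => /(_ isT) a2.
have {}a2 : a s.+2 <= (1 - s.+1%:R / r%:R) * a s.+1 + e ^+ 2.
  by apply: le_trans a2 _; rewrite lerD2l ge_min lexx orbT.
case: da => a01 _ _ /(_ s) MM.
have /andP[as0 as1] := a01 s; have /andP[aS0 aS1] := a01 s.+1.
have s0 : 0 <= s%:R :> R by [].
have sS : s.+1%:R = s%:R + 1 :> R by rewrite -natr1.
have q0 := turan_factor_ge0 R r0 sr.
rewrite sS in MM a2.
set S := s%:R in MM a2 s0 sS q0 *; set y := a s.+1 in MM a2 aS0 aS1 *.
set x := a s in MM as0 as1 *; set q := 1 - S / r%:R in q0 *.
have id1 : 1 + S * (1 - (S + 1) / r%:R) = (S + 1) * q by rewrite /q; ring.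
have MM2 : (S + 1) * y ^+ 2 <= (S + 1) * (x * q * y) + S * (x * e ^+ 2).
  apply: le_trans MM _.
  have -> : (S + 1) * (x * q * y) + S * (x * e ^+ 2) =
     x * (y + S * ((1 - (S + 1) / r%:R) * y + e ^+ 2)).
    rewrite [RHS](_ : _ = x * (1 + S * (1 - (S + 1) / r%:R)) * y
              + S * (x * e ^+ 2)); last by ring.
    by rewrite id1; ring.
  by apply: ler_wpM2l => //; rewrite lerD2l ler_wpM2l.
have MM3 : y ^+ 2 <= x * q * y + e ^+ 2.
  rewrite -(ler_pM2l (_ : 0 < S + 1)); last by rewrite ltr_wpDl.
  apply: le_trans MM2 _; rewrite (mulrDr (S + 1) (x * q * y)) lerD2l.
  have : x * e ^+ 2 <= e ^+ 2 by rewrite ler_piMl // exprn_ge0 // ltW.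
  have := exprn_ge0 2 (ltW e0); have : 0 <= x * e ^+ 2.
    by rewrite mulr_ge0 // exprn_ge0 // ltW.
  by nra.
rewrite leNgt; apply/negP => lt_y.
have qx0 : 0 <= q * x by rewrite mulr_ge0.
have le_ey : e <= y by lra.
have : e * e <= e * y by apply: ler_wpM2l => //; exact: ltW.
have : 0 < (y - q * x - e) * y by rewrite mulr_gt0 //; lra.
move: MM3; move: (q) => q'; nra.
Qed.

Lemma contract_le (R : realType) (q x y e : R) :
  0 <= q -> q <= 1 -> 0 <= e -> x <= y + e -> q * x <= q * y + e.
Proof. by move=> *; nra. Qed.

Lemma density_le_turan (R : realType) (r : nat) (eta : R) (a : nat -> R) :
  (0 < r)%N -> 0 <= eta -> a 0%N = 1 ->
  (forall s, (s <= r)%N -> a s.+1 <= (1 - s%:R / r%:R) * a s + eta) ->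
  forall s, (s <= r)%N -> a s <= turan R r s + s%:R * eta.
Proof.
move=> r0 eta0 a0 Ha; elim=> [|s IH] sr.
  by rewrite a0 /turan big_ord0 mul0r addr0.
apply: le_trans (Ha s (ltnW sr)) _; rewrite turanS -natr1.
have q0 := turan_factor_ge0 R r0 (ltnW sr).
have q1 := turan_factor_le1 R r s.
have := IH (ltnW sr); have : 0 <= s%:R * eta by rewrite mulr_ge0.
move=> E0 HE; rewrite (mulrDl _ 1) mul1r addrA lerD2r [_ * (1 - _)]mulrC.
exact: contract_le.
Qed.

Lemma density_chain (R : realType) (r : nat) (eta : R) (a : nat -> R) :
  (0 < r)%N -> 0 <= eta ->
  (forall s, (s <= r)%N -> a s.+1 <= (1 - s%:R / r%:R) * a s + eta) ->
  forall j, (j.+2 <= r)%N ->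
  a j.+2 <= \prod_(i < j) (1 - i.+2%:R / r%:R) * a 2%N + j%:R * eta.
Proof.
move=> r0 eta0 Ha; elim=> [|j IH] jr.
  by rewrite big_ord0 mul1r mul0r addr0.
apply: le_trans (Ha j.+2 (ltnW jr)) _; rewrite big_ord_recr /= -(natr1 j).
have q0 := turan_factor_ge0 R r0 (ltnW jr).
have q1 := turan_factor_le1 R r j.+2.
have := IH (ltnW jr); have : 0 <= j%:R * eta by rewrite mulr_ge0.
move=> E0 HE; rewrite (mulrDl _ 1) mul1r addrA lerD2r [_ * (1 - _)]mulrC -mulrA.
exact: contract_le.
Qed.

Lemma turan_split (R : realType) (r j : nat) :
  turan R r j.+2 = \prod_(i < j) (1 - i.+2%:R / r%:R) * (1 - r%:R^-1).
Proof.
rewrite /turan !big_ord_recl /= mul0r subr0 mul1r mulrC; congr (_ * _).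
by rewrite mul1r.
Qed.

(** Chaining the steps from s = 2 to s = k shows that a deficit of the edge
    density would cost a proportional deficit of the k-clique density. *)
Lemma density_stability (R : realType) (r k : nat) (zeta : R) :
  (2 <= k)%N -> (k <= r)%N -> 0 < zeta ->
  exists2 gamma : R, 0 < gamma & forall a : nat -> R, density_seq a ->
    a r.+1 <= gamma -> turan R r k - gamma <= a k ->
    1 - r%:R^-1 - zeta <= a 2%N /\
    forall s, (s <= r)%N -> a s <= turan R r s + zeta.
Proof.
move=> k2 kr zeta0.
have r0 : (0 < r)%N by apply: leq_trans kr; apply: leq_trans k2.
have r0' : 0 < r%:R :> R by rewrite ltr0n.
case: k k2 kr => [|[|j]] // _ jr.
pose P := \prod_(i < j) (1 - i.+2%:R / r%:R) : R.
have P0 : 0 < P.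
  apply: prodr_gt0 => i _; rewrite subr_gt0 ltr_pdivrMr // mul1r ltr_nat.
  by apply: leq_trans jr; rewrite !ltnS.
pose eta := Num.min (zeta / r%:R) (P * zeta / (2 * r%:R)).
have eta0 : 0 < eta.
  by rewrite lt_min !divr_gt0 ?mulr_gt0 //.
have [g g0 Hg] := density_step r0 eta0.
exists (Num.min g (P * zeta / 2)).
  by rewrite lt_min g0 divr_gt0 ?mulr_gt0.
move=> a da; rewrite le_min => /andP[ha _] hk.
have step := Hg a da ha; have a0 : a 0%N = 1 by case: da.
have le_eta s : (s <= r)%N -> s%:R * eta <= zeta.
  move=> sr; apply: (@le_trans _ _ (r%:R * (zeta / r%:R))).
    by rewrite ler_pM ?ler_nat ?(ltW eta0) // ge_min lexx.
  by rewrite mulrCA divff ?mulr1 ?gt_eqF.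
split; last first.
  move=> s sr; apply: le_trans (density_le_turan r0 (ltW eta0) a0 step sr) _.
  by rewrite lerD2l le_eta.
have H := density_chain r0 (ltW eta0) step jr.
rewrite -/P turan_split -/P in H hk.
have je : j%:R * eta <= P * zeta / 2.
  apply: (@le_trans _ _ (r%:R * (P * zeta / (2 * r%:R)))).
    rewrite ler_pM ?ler_nat ?(ltW eta0) //; last by rewrite ge_min lexx orbT.
    by apply: leq_trans jr; apply: leq_trans (leqnSn _) _.
  by rewrite le_eqVlt; apply/orP; left; apply/eqP; field; rewrite gt_eqF.
have gP : Num.min g (P * zeta / 2) <= P * zeta / 2 by rewrite ge_min lexx orbT.
rewrite -(ler_pM2l P0); nra.
Qed.

(** Read from below, the Moon-Moser inequality propagates a lower bound on
    the ratio of consecutive densities from the edges to the r-cliques. *)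
Lemma density_cliques_lb (R : realType) (r : nat) (a : nat -> R) :
  (2 <= r)%N -> density_seq a ->
  1 - r%:R^-1 - (2 * r%:R ^+ 2)^-1 <= a 2%N ->
  (2 * r%:R)^-1 ^+ r <= a r.
Proof.
move=> r2 [a01 a0 a1 MM] h2.
have r0 : 0 < r%:R :> R by rewrite ltr0n; apply: leq_trans r2.
pose u : R := r%:R^-1 + (2 * r%:R ^+ 2)^-1.
pose w : R := (2 * r%:R)^-1.
have w0 : 0 < w by rewrite invr_gt0 mulr_gt0.
have fac s : (s < r)%N -> w <= 1 - s%:R * u.
  move=> sr; have {}sr : s%:R <= r%:R - 1 :> R.
    by rewrite lerBrDr natr1 ler_nat.
  have u0 : 0 < u by rewrite addr_gt0 ?invr_gt0 ?mulr_gt0 ?exprn_gt0.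
  apply: (@le_trans _ _ (1 - (r%:R - 1) * u)); last by rewrite lerD2l lerN2 ler_pM2r.
  have -> : 1 - (r%:R - 1) * u = w + (2 * r%:R ^+ 2)^-1.
    by rewrite /u /w; field; rewrite gt_eqF.
  by rewrite lerDl invr_ge0 mulr_ge0 // exprn_ge0 // ltW.
suff H s : (s < r)%N -> w ^+ s.+1 <= a s.+1 /\ (1 - s.+1%:R * u) * a s.+1 <= a s.+2.
  have rp : (0 < r)%N by apply: leq_trans r2.
  by have := H r.-1; rewrite prednK // leqnn => /(_ isT) [].
elim: s => [|s IH] sr.
  rewrite expr1 a1 !mulr1 mul1r; split; last by rewrite /u; lra.
  by have := fac 0%N sr; rewrite mul0r subr0.
have [IH1 IH2] := IH (ltnW sr).
have b1 : w ^+ s.+2 <= a s.+2.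
  apply: le_trans IH2; rewrite exprS.
  by apply: ler_pM IH1; [exact: ltW | apply/ltW/exprn_gt0 | exact: fac].
split=> //.
have x0 : 0 < a s.+1 by apply: lt_le_trans IH1; rewrite exprn_gt0.
have y0 : 0 < a s.+2 by apply: lt_le_trans b1; rewrite exprn_gt0.
have := MM s.+1; rewrite -(natr1 s.+1).
set S := s.+1%:R in IH2 *; set x := a s.+1 in IH2 x0 *.
set y := a s.+2 in IH2 y0 *; set z := a s.+3 => M.
have S0 : 0 < S by rewrite ltr0n.
have : 0 <= (S + 1) * y * (y - (1 - S * u) * x).
  apply: mulr_ge0; last by rewrite subr_ge0.
  by rewrite ltW // mulr_gt0 // addr_gt0.
move=> N; rewrite -(ler_pM2l (mulr_gt0 S0 x0)); clearbody u S x y z; nra.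
Qed.

(** * Counting ordered cliques *)

Section Tuples.
Variable V : finType.

Definition insert_at (s : nat) (i : 'I_s.+1) (v : V) (f : {ffun 'I_s -> V}) :
    {ffun 'I_s.+1 -> V} :=
  [ffun j => if unlift i j is Some j' then f j' else v].

Definition delete_at (s : nat) (i : 'I_s.+1) (f : {ffun 'I_s.+1 -> V}) :
    {ffun 'I_s -> V} :=
  [ffun j => f (lift i j)].

Definition update (I : finType) (f : {ffun I -> V}) (i : I) (v : V) :
    {ffun I -> V} :=
  [ffun j => if j == i then v else f j].

Lemma insert_atE (s : nat) (i : 'I_s.+1) v f : insert_at i v f i = v.
Proof. by rewrite ffunE unlift_none. Qed.

Lemma insert_at_lift (s : nat) (i : 'I_s.+1) v f j :
  insert_at i v f (lift i j) = f j.
Proof. by rewrite ffunE liftK. Qed.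

Lemma delete_insert (s : nat) (i : 'I_s.+1) v f :
  delete_at i (insert_at i v f) = f.
Proof. by apply/ffunP=> j; rewrite ffunE insert_at_lift. Qed.

Lemma insert_delete (s : nat) (i : 'I_s.+1) (f : {ffun 'I_s.+1 -> V}) :
  insert_at i (f i) (delete_at i f) = f.
Proof.
apply/ffunP=> j; rewrite ffunE; case: unliftP => [j' ->|-> //].
by rewrite ffunE.
Qed.

Lemma sum_insert (s : nat) (i : 'I_s.+1) (F : {ffun 'I_s.+1 -> V} -> nat) :
  (\sum_f F f = \sum_g \sum_v F (insert_at i v g))%N.
Proof.
rewrite pair_big /=.
rewrite (reindex (fun p : {ffun 'I_s -> V} * V => insert_at i p.2 p.1)) //=.
exists (fun f => (delete_at i f, f i)) => [[g v] _|f _] /=.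
  by rewrite delete_insert insert_atE.
exact: insert_delete.
Qed.

Lemma sum_update (I : finType) (i : I) (F : {ffun I -> V} -> nat) :
  (\sum_f \sum_v F (update f i v) = #|V| * \sum_f F f)%N.
Proof.
rewrite pair_big /=.
(* swapping the old value with the new one is an involution *)
rewrite (reindex (fun p : {ffun I -> V} * V => (update p.1 i p.2, p.1 i))) /=.
  rewrite (eq_bigr (fun p : {ffun I -> V} * V => F p.1)) => [|[f v] _ /=].
    rewrite -(pair_big xpredT xpredT (fun f (_ : V) => F f)) /= big_distrr /=.
    by apply: eq_bigr => f _; rewrite sum_nat_const cardT.
  congr F; apply/ffunP=> j; rewrite !ffunE.
  by case: eqP => // ->.
apply: onW_bij; exists (fun p => (update p.1 i p.2, p.1 i)) => -[f v] /=;
  congr (_, _); rewrite ?ffunE ?eqxx //; apply/ffunP=> j; rewrite !ffunE;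
  by case: eqP => // ->.
Qed.

Definition cliqueb (G : rel V) (s : nat) (f : {ffun 'I_s -> V}) : bool :=
  [forall i, forall j, (i != j) ==> G (f i) (f j)].

Lemma cliqueP (G : rel V) (s : nat) (f : {ffun 'I_s -> V}) :
  reflect (forall i j, i != j -> G (f i) (f j)) (cliqueb G f).
Proof.
apply: (iffP forallP) => [H i j ij|H i].
  by have /forallP/(_ j)/implyP/(_ ij) := H i.
by apply/forallP=> j; apply/implyP; exact: H.
Qed.

Definition joined (G : rel V) (s : nat) (f : {ffun 'I_s -> V}) (v : V) : bool :=
  [forall i, G (f i) v].

Definition extensions (G : rel V) (s : nat) (f : {ffun 'I_s -> V}) : nat :=
  #|[pred v | joined G f v]|.

Definition cliques (G : rel V) (s : nat) : nat :=
  #|[pred f : {ffun 'I_s -> V} | cliqueb G f]|.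

Lemma clique_insert (G : rel V) (s : nat) (i : 'I_s.+1) v f : symmetric G ->
  cliqueb G (insert_at i v f) = cliqueb G f && joined G f v.
Proof.
move=> Gsym; apply/cliqueP/andP => [H|[/cliqueP H /forallP J] j j'].
  split.
    apply/cliqueP => j j' jj'.
    have := H (lift i j) (lift i j'); rewrite !insert_at_lift; apply.
    by rewrite (inj_eq lift_inj).
  apply/forallP=> j; have := H (lift i j) i.
  by rewrite insert_at_lift insert_atE; apply; rewrite eq_sym neq_lift.
case: (unliftP i j) => [a ->|->]; case: (unliftP i j') => [b ->|->].
- by rewrite (inj_eq lift_inj) !insert_at_lift; exact: H.
- by rewrite insert_at_lift insert_atE.
- by rewrite insert_at_lift insert_atE Gsym.
- by rewrite eqxx.
Qed.

Lemma card_pred_sum (T : finType) (P : pred T) :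
  (#|[pred x | P x]| = \sum_x P x)%N.
Proof. by rewrite -sum1_card [RHS]big_mkcond /= big_mkcond. Qed.

Lemma cliquesS (G : rel V) (s : nat) : symmetric G ->
  (cliques G s.+1 = \sum_(f : {ffun 'I_s -> V} | cliqueb G f) extensions G f)%N.
Proof.
move=> Gsym; rewrite /cliques card_pred_sum (sum_insert ord0) [RHS]big_mkcond /=.
apply: eq_bigr => f _; rewrite /extensions card_pred_sum.
case: ifP => Cf.
  by apply: eq_bigr => v _; rewrite clique_insert // Cf.
by rewrite big1 // => v _; rewrite clique_insert // Cf.
Qed.

(** A vertex joined to all of f but one entry is counted once on the left,
    and a vertex joined to all of f is counted s+1 times. *)
Lemma sum_extensions_delete (G : rel V) (s : nat) (f : {ffun 'I_s.+1 -> V}) :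
  (\sum_i extensions G (delete_at i f)
     <= #|V| + s * extensions G f)%N.
Proof.
rewrite /extensions card_pred_sum.
under eq_bigr => i _ do rewrite card_pred_sum.
rewrite exchange_big /= big_distrr /= -sum1_card -big_split /=.
apply: leq_sum => v _; case: (boolP (joined G f v)) => [_|].
  rewrite muln1 add1n -[X in (_ <= X)%N](card_ord s.+1) -sum1_card.
  by apply: leq_sum => i _; exact: leq_b1.
rewrite negb_forall => /existsP[j0 nj]; rewrite muln0 addn0.
rewrite (bigD1 j0) //= big1 ?addn0 ?leq_b1 // => i ij.
case: (boolP (joined _ _ _)) => // /forallP.
case: (unliftP i j0) ij nj => [j ->|->]; last by rewrite eqxx.
by move=> _ /negP nj /(_ j); rewrite ffunE.
Qed.

Lemma sum_square_le (T : finType) (P : pred T) (x : T -> nat) :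
  ((\sum_(i | P i) x i) ^ 2 <= #|P| * \sum_(i | P i) x i ^ 2)%N.
Proof.
set S2 := (\sum_(i | P i) x i ^ 2)%N.
have -> : ((\sum_(i | P i) x i) ^ 2 = \sum_(i | P i) \sum_(j | P j) x i * x j)%N.
  by rewrite expnS expn1 big_distrlr.
rewrite -(leq_pmul2l (isT : 0 < 2)%N) big_distrr /=.
apply: (@leq_trans (\sum_(i | P i) \sum_(j | P j) (x i ^ 2 + x j ^ 2))%N).
  apply: leq_sum => i _; rewrite big_distrr /=; apply: leq_sum => j _.
  exact: nat_Cauchy.
under eq_bigr => i _ do rewrite big_split /= sum_nat_const.
by rewrite big_split /= sum_nat_const -big_distrr /= -/S2 mul2n addnn.
Qed.

(** Deleting an entry of an (s+1)-clique gives every s-clique g as often as g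
    has extensions, for each of the s+1 positions of the deleted entry. *)
Lemma sum_square_extensions (G : rel V) (s : nat) : symmetric G ->
  (s.+1 * \sum_(g : {ffun 'I_s -> V} | cliqueb G g) extensions G g ^ 2
     <= #|V| * cliques G s.+1 + s * cliques G s.+2)%N.
Proof.
move=> Gsym.
have <- : (\sum_(f : {ffun 'I_s.+1 -> V} | cliqueb G f)
             \sum_i extensions G (delete_at i f)
           = s.+1 * \sum_(g : {ffun 'I_s -> V} | cliqueb G g) extensions G g ^ 2)%N.
  rewrite exchange_big /= -[s.+1 in RHS]card_ord -sum_nat_const.
  apply: eq_bigr => i _; rewrite big_mkcond (sum_insert i) [RHS]big_mkcond /=.
  apply: eq_bigr => g _.
  under eq_bigr => v _ do rewrite clique_insert // delete_insert.
  case: (cliqueb G g) => /=; last by rewrite big1.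
  rewrite -big_mkcond /= sum_nat_const mulnC expnS expn1.
  by congr (_ * _)%N; apply: eq_card.
rewrite [X in (_ + s * X)%N]cliquesS // big_distrr /= mulnC -sum_nat_const.
rewrite -big_split /=; apply: leq_sum => f _.
exact: sum_extensions_delete.
Qed.

(** The (s+1)-cliques are the extensions of the s-cliques, so the inequality
    follows from the previous one by Cauchy-Schwarz. *)
Lemma moon_moser (G : rel V) (s : nat) : symmetric G ->
  (s.+1 * cliques G s.+1 ^ 2
     <= cliques G s * (#|V| * cliques G s.+1 + s * cliques G s.+2))%N.
Proof.
move=> Gsym; apply: leq_trans (leq_mul (leqnn _) (sum_square_extensions s Gsym)).
rewrite mulnCA leq_mul2l /= cliquesS //.
exact: sum_square_le.
Qed.

Lemma cliques0 (G : rel V) : cliques G 0 = 1%N.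
Proof.
rewrite /cliques (eq_card (B := predT)).
  by rewrite card_ffun card_ord expn0.
by move=> f; rewrite !inE; apply/cliqueP => -[].
Qed.

Lemma cliques1 (G : rel V) : cliques G 1 = #|V|.
Proof.
rewrite /cliques (eq_card (B := predT)).
  by rewrite card_ffun card_ord expn1.
by move=> f; rewrite !inE; apply/cliqueP => i j; rewrite !ord1 eqxx.
Qed.

Lemma cliques_le (G : rel V) (s : nat) : (cliques G s <= #|V| ^ s)%N.
Proof.
rewrite -[s in X in (_ <= X)%N]card_ord -card_ffun; exact: max_card.
Qed.

End Tuples.

Definition clique_density (R : realType) (V : finType) (G : rel V) (s : nat) : R :=
  (cliques G s)%:R / #|V|%:R ^+ s.

Lemma density_seq_cliques (R : realType) (V : finType) (G : rel V) :
  (0 < #|V|)%N -> symmetric G -> density_seq (clique_density R G).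
Proof.
move=> n0 Gsym; have n0' : 0 < #|V|%:R :> R by rewrite ltr0n.
have nz : #|V|%:R != 0 :> R by rewrite gt_eqF.
rewrite /clique_density; split=> [s|||s].
- apply/andP; split; first by rewrite divr_ge0 ?exprn_ge0.
  by rewrite ler_pdivrMr ?exprn_gt0 // mul1r -natrX ler_nat cliques_le.
- by rewrite cliques0 expr0 divr1.
- by rewrite cliques1 expr1 divff.
have := moon_moser s Gsym.
rewrite -(ler_nat R) !(natrM, natrD, natrX).
set n := #|V|%:R in n0' nz *; set A := _%:R; set B := _%:R; set C := _%:R.
set D := _%:R; set E := _%:R => H.
have nzX j : n ^+ j != 0 by rewrite expf_eq0 (negbTE nz) andbF.
have P0 : 0 < n ^+ s * n ^+ s.+2 by rewrite mulr_gt0 ?exprn_gt0.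
rewrite -(ler_pM2l P0).
have -> : n ^+ s * n ^+ s.+2 * (A * (B / n ^+ s.+1) ^+ 2) = A * B ^+ 2.
  by rewrite !exprS; field; rewrite nz nzX.
apply: le_trans H _; rewrite le_eqVlt; apply/orP; left; apply/eqP.
by rewrite !exprS; field; rewrite nz nzX.
Qed.

(** * Complete multipartite patterns in dense sets of tuples *)

Lemma sum_joint_images (V : finType) (m : nat)
    (P : pred {ffun 'I_m.+1 -> V}) :
  (\sum_(t : {ffun 'I_3 -> V})
      #|[pred g : {ffun 'I_m -> V} | [forall b, P (insert_at ord0 (t b) g)]]|
   = \sum_(g : {ffun 'I_m -> V}) #|[pred v | P (insert_at ord0 v g)]| ^ 3)%N.
Proof.
under eq_bigr => t _ do rewrite card_pred_sum.
rewrite exchange_big /=; apply: eq_bigr => g _.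
rewrite -[X in (_ ^ X)%N](card_ord 3) -card_ffun_on -sum1_card [RHS]big_mkcond /=.
apply: eq_bigr => t _; set p := [forall b, _].
suff -> : (t \in ffun_on [pred v | P (insert_at ord0 v g)]) = p by case: p.
by apply/ffun_onP/forallP => H b; have := H b; rewrite inE.
Qed.

Lemma card_noninjective_triples (V : finType) :
  (#|[pred t : {ffun 'I_3 -> V} | ~~ injectiveb t]| <= 3 * #|V| ^ 2)%N.
Proof.
have := cardC [pred t : {ffun 'I_3 -> V} | injectiveb t].
have -> : #|[pred t : {ffun 'I_3 -> V} | injectiveb t]| = (#|V| ^_ 3)%N.
  rewrite -[X in (_ ^_ X)%N](card_ord 3) -card_inj_ffuns.
  by apply: eq_card => t; rewrite !inE.
rewrite card_ffun card_ord !ffactnS ffactn0 muln1.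
rewrite (eq_card (B := [pred t : {ffun 'I_3 -> V} | ~~ injectiveb t])) //.
set X := #|_|; case: #|V| => [|[|n]] /=; rewrite ?expnS ?expn0; lia.
Qed.

(** Tangent line of the cube at b, which plays the role of convexity. *)
Lemma cube_tangent (R : realType) (x b : R) :
  0 <= x -> 0 <= b -> 3 * b ^+ 2 * x - 2 * b ^+ 3 <= x ^+ 3.
Proof.
move=> x0 b0; rewrite -subr_ge0.
have -> : x ^+ 3 - (3 * b ^+ 2 * x - 2 * b ^+ 3) = (x - b) ^+ 2 * (x + 2 * b).
  by ring.
by rewrite mulr_ge0 ?sqr_ge0 // addr_ge0 // mulr_ge0.
Qed.

(** Erdos' theorem on complete m-partite m-uniform hypergraphs, for parts of
    size three. By convexity a positive proportion of the triples t of
    vertices have a positive proportion of common (m-1)-tuples g, and all but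
    O(n^2) triples consist of distinct vertices; induction applies to the
    tuples g of one such triple. *)
Lemma box_theorem (R : realType) (m : nat) (c : R) : 0 < c ->
  exists n0 : nat, forall (V : finType) (P : pred {ffun 'I_m -> V}),
    (n0 <= #|V|)%N -> c * #|V|%:R ^+ m <= #|[pred f | P f]|%:R ->
    exists2 W : 'I_m -> 'I_3 -> V, forall i, injective (W i) &
      forall a : {ffun 'I_m -> 'I_3}, P [ffun i => W i (a i)].
Proof.
elim: m c => [|m IH] c c0.
  exists 1%N => V P /card_gt0P[v _]; rewrite expr0 mulr1 => H.
  have /card_gt0P[f] : (0 < #|[pred f | P f]|)%N.
    by rewrite -(ltr0n R); apply: lt_le_trans H.
  rewrite inE => Pf; exists (fun _ _ => v) => [[]//|a].
  by rewrite (_ : [ffun _ => _] = f) //; apply/ffunP=> -[].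
have c30 : 0 < c ^+ 3 / 2 by rewrite divr_gt0 ?exprn_gt0.
have [n1 Hn1] := IH _ c30.
(* beyond n2 the triples with a repeated vertex are negligible *)
pose n2 := (Num.truncn (6 / c ^+ 3)).+1.
exists (maxn n1 n2) => V P; rewrite geq_max => /andP[Vn1 Vn2] HP.
pose n : R := #|V|%:R.
have nbig : 6 / c ^+ 3 < n.
  apply: (@lt_le_trans _ _ n2%:R); last by rewrite ler_nat.
  by rewrite /n2 truncnS_gt.
have n0 : 0 < n by apply: lt_trans nbig; rewrite divr_gt0 ?exprn_gt0.
pose Q (t : {ffun 'I_3 -> V}) : pred {ffun 'I_m -> V} :=
  fun g => [forall b, P (insert_at ord0 (t b) g)].
suff [t /injectiveP tinj Ht] : exists2 t : {ffun 'I_3 -> V}, injectiveb t &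
    c ^+ 3 / 2 * n ^+ m <= #|[pred g | Q t g]|%:R.
  have [W Winj HW] := Hn1 V (Q t) Vn1 Ht.
  exists (fun i => if unlift ord0 i is Some j then W j else t) => [i|a].
    by case: (unlift ord0 i) => [j|]; [exact: Winj | exact: tinj].
  have /forallP/(_ (a ord0)) := HW (delete_at ord0 a).
  congr (P _); apply/ffunP=> i; rewrite !ffunE.
  by case: unliftP => [j ->|-> //]; rewrite !ffunE.
pose N (g : {ffun 'I_m -> V}) := #|[pred v | P (insert_at ord0 v g)]|.
have sumN : (\sum_g N g)%N = #|[pred f | P f]|.
  rewrite [RHS]card_pred_sum (sum_insert ord0); apply: eq_bigr => g _.
  by rewrite /N card_pred_sum.
have card_g : (\sum_(g : {ffun 'I_m -> V}) 1 = n ^+ m :> R).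
  by rewrite sumr_const card_ffun card_ord natrX.
have cubes : (c * n) ^+ 3 * n ^+ m <=
    (\sum_(t : {ffun 'I_3 -> V}) #|[pred g | Q t g]|)%:R.
  rewrite sum_joint_images -/N natr_sum.
  apply: (@le_trans _ _ (\sum_g (3 * (c * n) ^+ 2 * (N g)%:R - 2 * (c * n) ^+ 3))).
    rewrite big_split /= -big_distrr /= -natr_sum sumN.
    under [X in _ <= _ + X]eq_bigr => g _ do rewrite -[X in - X]mulr1 -mulNr.
    rewrite -big_distrr /= card_g.
    have : 3 * (c * n) ^+ 2 * (c * n ^+ m.+1) <=
       3 * (c * n) ^+ 2 * #|[pred f | P f]|%:R.
      by rewrite ler_wpM2l // mulr_ge0 ?sqr_ge0.
    rewrite [n ^+ m.+1]exprS; set E := n ^+ m; set F := _%:R => H.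
    apply: (@le_trans _ _ (3 * (c * n) ^+ 2 * (c * (n * E)) - 2 * (c * n) ^+ 3 * E)).
      by rewrite le_eqVlt; apply/orP; left; apply/eqP; ring.
    by rewrite mulNr lerD2r.
  apply: ler_sum => g _; rewrite natrX; apply: cube_tangent => //.
  by rewrite mulr_ge0 // ltW.
case: (pselect (exists2 t : {ffun 'I_3 -> V}, injectiveb t &
    c ^+ 3 / 2 * n ^+ m <= #|[pred g | Q t g]|%:R)) => // noT.
exfalso; move: cubes; apply/negP; rewrite -ltNge.
rewrite natr_sum (bigID (fun t : {ffun 'I_3 -> V} => injectiveb t)) /=.
have inj_part : \sum_(t : {ffun 'I_3 -> V} | injectiveb t) #|[pred g | Q t g]|%:R
    <= n ^+ 3 * (c ^+ 3 / 2 * n ^+ m).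
  apply: (@le_trans _ _ (\sum_(t : {ffun 'I_3 -> V}) c ^+ 3 / 2 * n ^+ m)).
    rewrite big_mkcond; apply: ler_sum => t _; case: ifP => [tinj|_].
      by rewrite leNgt; apply/negP => /ltW ?; apply: noT; exists t.
    by rewrite mulr_ge0 ?exprn_ge0 // ltW.
  by rewrite sumr_const card_ffun card_ord -[X in X <= _]mulr_natl natrX.
have ninj_part : \sum_(t : {ffun 'I_3 -> V} | ~~ injectiveb t)
    #|[pred g | Q t g]|%:R <= 3 * n ^+ 2 * n ^+ m :> R.
  apply: (@le_trans _ _ (\sum_(t : {ffun 'I_3 -> V} | ~~ injectiveb t) n ^+ m)).
    apply: ler_sum => t _; rewrite -natrX ler_nat.
    by rewrite -[X in (_ <= _ ^ X)%N](card_ord m) -card_ffun max_card.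
  rewrite sumr_const -[X in X <= _]mulr_natl ler_wpM2r ?exprn_ge0 ?(ltW n0) //.
  by rewrite -natrX -natrM ler_nat card_noninjective_triples.
apply: le_lt_trans (lerD inj_part ninj_part) _.
have -> : (c * n) ^+ 3 * n ^+ m = n ^+ 3 * (c ^+ 3 / 2 * n ^+ m)
   + (c ^+ 3 * n) / 2 * n ^+ 2 * n ^+ m by field.
rewrite ltrD2l ltr_pM2r ?exprn_gt0 // ltr_pM2r ?exprn_gt0 //.
rewrite ltr_pdivlMr // -natrM mulrC -ltr_pdivrMr ?exprn_gt0 //.
Qed.

(** * Counting tuples through their subtuples *)

(** A tuple is determined by its entries along h and its entries outside the
    range of h. *)
Lemma card_pullback (V I J : finType) (h : I -> J) (S : pred {ffun I -> V}) :
  injective h ->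
  (#|[pred f : {ffun J -> V} | S [ffun i => f (h i)]]| * #|V| ^ #|I|
     <= #|[pred g | S g]| * #|V| ^ #|J|)%N.
Proof.
move=> hinj; pose K : finType := {j : J | j \notin codom h}.
have cardK : #|K| = (#|J| - #|I|)%N.
  have := cardC (mem (codom h)); rewrite card_codom // => <-.
  by rewrite addKn card_sig; apply: eq_card => j; rewrite !inE.
have leIJ : (#|I| <= #|J|)%N by rewrite -(card_codom hinj) max_card.
have -> : (#|V| ^ #|J| = #|V| ^ #|K| * #|V| ^ #|I|)%N.
  by rewrite cardK -expnD subnK.
rewrite mulnA leq_mul2r; apply/orP; right.
rewrite -card_ffun -cardX.
pose e (f : {ffun J -> V}) : {ffun I -> V} * {ffun K -> V} :=
  ([ffun i => f (h i)], [ffun j => f (val j)]).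
have einj : injective e.
  move=> f g [/ffunP E1 /ffunP E2]; apply/ffunP => j.
  case: (boolP (j \in codom h)) => [/codomP[i ->]|jh].
    by have := E1 i; rewrite !ffunE.
  by have := E2 (Sub j jh); rewrite !ffunE.
rewrite -(fintype.card_image einj); apply: subset_leq_card; apply/fintype.subsetP => p.
by case/fintype.imageP=> f; rewrite !inE => Sf ->; rewrite /= Sf.
Qed.

Lemma card_cover (V I J : finType) (S : pred {ffun I -> V})
    (B : pred {ffun J -> V}) :
  (forall f, B f -> exists2 h : {ffun I -> J}, injective h &
     S [ffun i => f (h i)]) ->
  (#|[pred f | B f]| * #|V| ^ #|I|
     <= #|J| ^ #|I| * (#|[pred g | S g]| * #|V| ^ #|J|))%N.
Proof.
move=> HB; rewrite -(card_ffun I J) -[X in (_ <= X)%N]sum_nat_const.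
apply: (@leq_trans (\sum_(h : {ffun I -> J} | injectiveb h)
   #|[pred f : {ffun J -> V} | S [ffun i => f (h i)]]| * #|V| ^ #|I|)%N).
  rewrite -big_distrl /= leq_mul2r; apply/orP; right.
  rewrite card_pred_sum (eq_bigr _ (fun h _ => card_pred_sum _)).
  rewrite exchange_big /=; apply: leq_sum => f _.
  case: (boolP (B f)) => //= /HB[h /injectiveP hinj Sh].
  by rewrite (bigD1 h) //= Sh.
rewrite [X in (_ <= X)%N](bigID (fun h : {ffun I -> J} => injectiveb h)) /=.
apply: leq_trans (leq_addr _ _); apply: leq_sum => h /injectiveP.
exact: card_pullback.
Qed.

Lemma card_cover_real (R : realType) (V I J : finType) (s : R)
    (S : pred {ffun I -> V}) (B : pred {ffun J -> V}) :
  (0 < #|V|)%N ->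
  (forall f, B f -> exists2 h : {ffun I -> J}, injective h &
     S [ffun i => f (h i)]) ->
  #|[pred g | S g]|%:R <= s * #|V|%:R ^+ #|I| ->
  #|[pred f | B f]|%:R <= #|J|%:R ^+ #|I| * s * #|V|%:R ^+ #|J|.
Proof.
move=> V0 HB HS.
have P0 : 0 < #|V|%:R ^+ #|I| :> R by rewrite exprn_gt0 // ltr0n.
rewrite -(ler_pM2r P0); move: (card_cover HB).
rewrite -(ler_nat R) !(natrM, natrX) => /le_trans; apply.
rewrite -!mulrA ler_wpM2l ?exprn_ge0 // [X in _ <= _ * X]mulrC mulrA.
by rewrite ler_wpM2r ?exprn_ge0.
Qed.

Lemma markov_count (R : realType) (T : finType) (P : pred T) (F : T -> nat)
    (s t : R) : 0 < t ->
  (\sum_(x | P x) F x)%:R <= s -> #|[pred x | P x && (t < (F x)%:R)]|%:R <= s / t.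
Proof.
move=> t0 Hs; rewrite ler_pdivlMr //; apply: le_trans Hs.
rewrite -sum1_card natr_sum mulr_suml natr_sum [leLHS]big_mkcond [leRHS]big_mkcond.
apply: ler_sum => x _; rewrite !inE mul1r; case: (P x) => //=.
by case: ifP => // /ltW.
Qed.

Lemma third_index (k : nat) (i j : 'I_k) :
  (3 <= k)%N -> exists2 l, l != i & l != j.
Proof.
move=> k3; have : (0 < #|[predC pred2 i j]|)%N.
  rewrite -(ltn_add2l #|pred2 i j|) cardC card_ord card2 addn0.
  by apply: leq_trans k3; case: (i != j).
by case/card_gt0P => l; rewrite !inE negb_or => /andP[]; exists l.
Qed.

Lemma injection_through (k r : nat) (i j l : 'I_r) :
  (3 <= k <= r)%N -> i != j -> i != l -> j != l ->
  exists2 h : {ffun 'I_k -> 'I_r}, injective h &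
    exists a b c, [/\ a != b, a != c, h a = i, h b = j & h c = l].
Proof.
move=> /andP[k3 kr] ij il jl.
pose t := [:: i; j; l]; pose s := t ++ [seq x <- enum 'I_r | x \notin t].
have ut : uniq t by rewrite /= !inE negb_or ij il jl.
have us : uniq s.
  rewrite cat_uniq ut filter_uniq ?enum_uniq // andbT.
  by apply/hasPn => x; rewrite mem_filter => /andP[].
have ss : size s = r.
  rewrite -[RHS](card_ord r) cardE; apply/perm_size/uniq_perm => //.
    exact: enum_uniq.
  by move=> x; rewrite mem_cat mem_filter mem_enum andbT orbN.
exists [ffun x : 'I_k => nth i s x].
  move=> x y; rewrite !ffunE => /eqP; rewrite nth_uniq ?ss //.
  - by move/eqP/val_inj.
  - exact: leq_trans (ltn_ord x) kr.
  - exact: leq_trans (ltn_ord y) kr.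
have h0 : (0 < k)%N by lia.
have h1 : (1 < k)%N by lia.
have h2 : (2 < k)%N by lia.
by exists (Ordinal h0), (Ordinal h1), (Ordinal h2); rewrite !ffunE.
Qed.

(** * Equilateral triangles and the graph of rich pairs *)

Section Colours.
Variables (R : realType) (V : finType) (col : V -> V -> R).
Hypothesis col_sym : forall x y, col x y = col y x.

Definition equilateral (x y z : V) : bool :=
  [&& x != y, x != z, y != z, col x y == col x z & col x y == col y z].

(** Edges of every length are treated alike: passing from the distance to
    this graph is what allows simplices of different sizes. *)
Definition rich (d : R) (x y : V) : bool :=
  (x != y) && (d * #|V|%:R <= #|[pred z | equilateral x y z]|%:R).

Definition regular (k : nat) (f : {ffun 'I_k -> V}) : bool :=
  injectiveb f &&
  [forall p : 'I_k * 'I_k, forall q : 'I_k * 'I_k,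
     (p.1 != p.2) ==> (q.1 != q.2) ==>
     (col (f p.1) (f p.2) == col (f q.1) (f q.2))].

Lemma regularP (k : nat) (f : {ffun 'I_k -> V}) :
  reflect (injective f /\ forall i j i' j', i != j -> i' != j' ->
             col (f i) (f j) = col (f i') (f j'))
          (regular f).
Proof.
apply: (iffP andP) => [[/injectiveP finj /forallP H]|[finj H]]; split=> //.
- move=> i j i' j' ij ij'.
  by have /forallP/(_ (i', j'))/implyP/(_ ij)/implyP/(_ ij')/eqP := H (i, j).
- exact/injectiveP.
apply/forallP=> -[i j]; apply/forallP=> -[i' j'].
by apply/implyP => ij; apply/implyP => ij'; apply/eqP; exact: H.
Qed.

Lemma equilateral_sym x y z : equilateral x y z = equilateral y x z.
Proof.
rewrite /equilateral (col_sym y x) (eq_sym y x).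
by case: (x == y); case: (x == z); case: (y == z);
  case: (col x y == col x z); case: (col x y == col y z).
Qed.

Lemma rich_sym d : symmetric (rich d).
Proof.
move=> x y; rewrite /rich eq_sym; congr (_ && (_ <= _%:R)).
by apply: eq_card => z; rewrite !inE equilateral_sym.
Qed.

Lemma rich_neq d x y : rich d x y -> x != y.
Proof. by case/andP. Qed.

Lemma clique_inj d k (f : {ffun 'I_k -> V}) : cliqueb (rich d) f -> injective f.
Proof.
move=> /cliqueP Cf i j E; apply/eqP/negPn/negP => /Cf.
by rewrite E /rich eqxx.
Qed.

Definition poor_triangle (d : R) (t : {ffun 'I_3 -> V}) : bool :=
  let x := t (lift ord_max ord0) in let y := t (lift ord_max ord_max) in
  ~~ rich d x y && equilateral x y (t ord_max).

Lemma card_poor_triangle (d : R) : 0 <= d ->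
  #|[pred t | poor_triangle d t]|%:R <= d * #|V|%:R ^+ 3.
Proof.
move=> d0; rewrite card_pred_sum (sum_insert ord_max) natr_sum.
apply: (@le_trans _ _ (\sum_(g : {ffun 'I_2 -> V}) d * #|V|%:R)); last first.
  rewrite sumr_const card_ffun card_ord -[X in X <= _]mulr_natl natrX.
  by rewrite mulrCA -exprSr.
apply: ler_sum => g _; rewrite -card_pred_sum.
pose x := g ord0; pose y := g ord_max.
rewrite (eq_card (B := [pred z | ~~ rich d x y && equilateral x y z])); last first.
  by move=> z; rewrite !inE /poor_triangle !insert_at_lift insert_atE.
case: (boolP (rich d x y)) => rxy /=.
  by rewrite eq_card0 ?mulr_ge0.
rewrite /rich negb_and negbK in rxy.
case/orP: rxy => [/eqP xy|].
  by rewrite eq_card0 ?mulr_ge0 // => z; rewrite inE /equilateral xy eqxx.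
by rewrite -ltNge => /ltW.
Qed.

(** A regular tuple with a pair of entries that is not rich contains, as it
    has a third entry, an equilateral triangle on a pair that lies in few of
    them. *)
Lemma card_regular_not_clique (d : R) (k : nat) :
  (0 < #|V|)%N -> (3 <= k)%N -> 0 <= d ->
  #|[pred f : {ffun 'I_k -> V} | regular f && ~~ cliqueb (rich d) f]|%:R
    <= k%:R ^+ 3 * d * #|V|%:R ^+ k.
Proof.
move=> V0 k3 d0.
have := @card_cover_real R V 'I_3 'I_k d (poor_triangle d)
  (fun f => regular f && ~~ cliqueb (rich d) f) V0.
rewrite !card_ord; apply; last exact: card_poor_triangle.
move=> f /andP[/regularP[finj Hf]].
rewrite negb_forall => /existsP[i]; rewrite negb_forall => /existsP[j].
rewrite negb_imply => /andP[ij nr].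
have [l li lj] := third_index i j k3.
pose h : {ffun 'I_3 -> 'I_k} := [ffun x : 'I_3 => nth i [:: i; j; l] x].
have hinj : injective h.
  move=> x y; rewrite !ffunE => /eqP; rewrite nth_uniq ?ltn_ord //.
    by move/eqP/val_inj.
  by rewrite /= !inE negb_or ij ![_ == l]eq_sym li lj.
exists h => //; rewrite /poor_triangle !ffunE /= nr /equilateral.
rewrite !(inj_eq finj) ij ![_ == l]eq_sym li lj /=.
by rewrite (Hf i j i l) ?(Hf i l j l) ?eqxx // eq_sym.
Qed.

(** Colours propagate along adjacent pairs, so a tuple that is not regular
    already fails to be on three entries, hence on some k of its entries. *)
Lemma card_irregular_cliques (d : R) (k r : nat) (s : R) :
  (0 < #|V|)%N -> (3 <= k <= r)%N ->
  #|[pred f : {ffun 'I_k -> V} | cliqueb (rich d) f && ~~ regular f]|%:R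
    <= s * #|V|%:R ^+ k ->
  #|[pred f : {ffun 'I_r -> V} | cliqueb (rich d) f && ~~ regular f]|%:R
    <= r%:R ^+ k * s * #|V|%:R ^+ r.
Proof.
move=> V0 kr Hs.
have := @card_cover_real R V 'I_k 'I_r s
  (fun f => cliqueb (rich d) f && ~~ regular f)
  (fun f => cliqueb (rich d) f && ~~ regular f) V0.
rewrite !card_ord; apply => // f /andP[Cf].
have finj := clique_inj Cf; move/cliqueP: Cf => Cf nreg.
apply: contrapT => noh; move/negP: nreg; apply; apply/regularP; split=> //.
have step i j l : i != j -> i != l -> j != l -> col (f i) (f j) = col (f i) (f l).
  move=> ij il jl; have [h hinj [a [b [c [ab ac ha hb hc]]]]] :=
    injection_through kr ij il jl.
  have [/regularP[_ H]|nreg] := boolP (regular [ffun x => f (h x)]).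
    by have := H a b a c ab ac; rewrite !ffunE ha hb hc.
  case: noh; exists h => //; rewrite nreg andbT.
  by apply/cliqueP => x y xy; rewrite !ffunE Cf // (inj_eq hinj).
have step' i j l : i != j -> i != l -> col (f i) (f j) = col (f i) (f l).
  by move=> ij il; have [->//|] := eqVneq j l; exact: step.
move=> i j i' j' ij ij'; have [ii'|ii'] := eqVneq i i'.
  by rewrite -ii' in ij' *; exact: step'.
rewrite (step' _ _ _ ij ii') col_sym; apply: step' => //.
by rewrite eq_sym.
Qed.

(** Every pair of entries of a clique has at least d n apexes, so there are
    many ways to choose one apex for every pair; averaging fixes one choice
    of apexes that serves a positive proportion of all tuples. *)
Lemma common_apexes (d g : R) (m : nat) :
  (0 < #|V|)%N -> 0 < d <= 1 -> 0 < g ->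
  g * #|V|%:R ^+ m <= (cliques (rich d) m)%:R ->
  exists z : {ffun 'I_m * 'I_m -> V},
    g * d ^+ #|{: 'I_m * 'I_m}| * #|V|%:R ^+ m <=
    #|[pred f : {ffun 'I_m -> V} | [forall p, (p.1 != p.2) ==>
         equilateral (f p.1) (f p.2) (z p)]]|%:R.
Proof.
move=> V0 /andP[d0 d1] g0 Hg; set D := #|{: _}|.
pose E (f : {ffun 'I_m -> V}) (z : {ffun 'I_m * 'I_m -> V}) :=
  [forall p, (p.1 != p.2) ==> equilateral (f p.1) (f p.2) (z p)].
pose n : R := #|V|%:R; have n0 : 0 < n by rewrite ltr0n.
have many f : cliqueb (rich d) f -> (d * n) ^+ D <= #|[pred z | E f z]|%:R.
  move=> /cliqueP Cf.
  pose F p v := (p.1 != p.2) ==> equilateral (f p.1) (f p.2) v.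
  have -> : (#|[pred z | E f z]| = \prod_p #|[pred v | F p v]|)%N.
    rewrite card_pred_sum [RHS](eq_bigr _ (fun p _ => card_pred_sum _)).
    rewrite bigA_distr_bigA /=; apply: eq_bigr => z _.
    have [/forallP H|] := boolP (E f z).
      by rewrite big1 // => p _; rewrite /F H.
    rewrite negb_forall => /existsP[p /negbTE np].
    by rewrite (bigD1 p) //= /F np.
  rewrite natr_prod /D -prodr_const.
  apply: ler_prod => p _; rewrite mulr_ge0 ?(ltW d0) ?(ltW n0) //=.
  have [pE|pN] := eqVneq p.1 p.2.
    rewrite (eq_card (B := predT)); last by move=> v; rewrite !inE /F pE eqxx.
    by apply: (@le_trans _ _ n) => //; rewrite ler_piMl // ltW.
  have /andP[_ H] := Cf _ _ pN; apply: le_trans H _; rewrite ler_nat.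
  by apply/subset_leq_card/fintype.subsetP => v; rewrite !inE /F pN.
apply: contrapT => noz.
have {}noz z : #|[pred f | E f z]|%:R < g * d ^+ D * n ^+ m.
  by rewrite ltNge; apply/negP => H; apply: noz; exists z.
have : g * n ^+ m * (d * n) ^+ D <= (\sum_z #|[pred f | E f z]|)%:R.
  rewrite (eq_bigr _ (fun z _ => card_pred_sum _)) exchange_big /= natr_sum.
  apply: (@le_trans _ _ (\sum_(f | cliqueb (rich d) f) (d * n) ^+ D)).
    rewrite sumr_const -[X in _ <= X]mulr_natl.
    apply: ler_wpM2r; last exact: Hg.
    by apply/exprn_ge0/mulr_ge0; exact: ltW.
  rewrite big_mkcond; apply: ler_sum => f _; rewrite -card_pred_sum.
  by case: ifP => // /many.
apply/negP; rewrite -ltNge natr_sum.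
apply: (@lt_le_trans _ _ (\sum_(z : {ffun 'I_m * 'I_m -> V}) g * d ^+ D * n ^+ m)).
  have [v _] := card_gt0P V0.
  by apply: ltr_sum => [|z _]; [apply/hasP; exists [ffun=> v] | exact: noz].
rewrite sumr_const card_ffun -[X in X <= _]mulr_natl natrX -/n.
by rewrite exprMn le_eqVlt; apply/orP; left; apply/eqP; rewrite -/D; ring.
Qed.

End Colours.

(** * Cliques whose common neighbourhoods reveal the parts *)

Section GoodTuples.
Variables (R : realType) (V : finType) (col : V -> V -> R).
Hypothesis V_gt0 : (0 < #|V|)%N.
Hypothesis col_sym : forall x y, col x y = col y x.

Let n : R := #|V|%:R.
Let n_gt0 : 0 < n. Proof. by rewrite ltr0n. Qed.

Definition vertex_tuple (v : V) : {ffun 'I_1 -> V} := [ffun=> v].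

Lemma extensions_vertex (G : rel V) v :
  extensions G (vertex_tuple v) = #|[pred u | G v u]|.
Proof.
apply: eq_card => u; rewrite !inE; apply/forallP/idP => [/(_ ord0)|H i].
  by rewrite ffunE.
by rewrite ffunE.
Qed.

(** By Moon and Moser a bound on the triangles bounds the sum of the squared
    degrees, here by nearly its value for a regular graph of the same edge
    density; so the degrees have a small variance. *)
Lemma card_low_degree (G : rel V) (p zeta eta : R) : symmetric G ->
  0 <= p <= 1 -> 0 <= zeta -> 0 < eta ->
  p - zeta <= clique_density R G 2 <= p + zeta ->
  clique_density R G 3 <= p * (2 * p - 1) + zeta ->
  #|[pred g : {ffun 'I_1 -> V} | (extensions G g)%:R < (p - eta) * n]|%:R
    <= 3 * zeta / eta ^+ 2 * n.
Proof.
move=> Gsym /andP[p0 p1] z0 e0; rewrite /clique_density -/n => /andP[].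
rewrite ler_pdivlMr ?exprn_gt0 // => lo.
rewrite ler_pdivrMr ?exprn_gt0 // => hi.
rewrite ler_pdivrMr ?exprn_gt0 // => tri.
have all1 (g : {ffun 'I_1 -> V}) : cliqueb G g.
  by apply/cliqueP => i j; rewrite !ord1 eqxx.
have S1 : \sum_(g : {ffun 'I_1 -> V}) (extensions G g)%:R = (cliques G 2)%:R :> R.
  rewrite cliquesS // natr_sum; apply: eq_bigl => g; by rewrite all1.
have S2 : 2 * \sum_(g : {ffun 'I_1 -> V}) (extensions G g)%:R ^+ 2
    <= n * (cliques G 2)%:R + (cliques G 3)%:R.
  have -> : \sum_(g : {ffun 'I_1 -> V}) (extensions G g)%:R ^+ 2 =
     (\sum_(g : {ffun 'I_1 -> V} | cliqueb G g) extensions G g ^ 2)%:R :> R.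
    by rewrite natr_sum; apply: eq_big => [g|g _]; rewrite ?all1 ?natrX.
  rewrite -!natrM -natrD ler_nat.
  by have := sum_square_extensions 1 Gsym; rewrite mul1n.
pose D (g : {ffun 'I_1 -> V}) : R := (extensions G g)%:R - p * n.
have var : \sum_g D g ^+ 2 <= 3 * zeta * n ^+ 3.
  have -> : \sum_g D g ^+ 2 =
      \sum_(g : {ffun 'I_1 -> V}) (extensions G g)%:R ^+ 2
      - 2 * (p * n) * (cliques G 2)%:R + n * (p * n) ^+ 2.
    rewrite -S1 big_distrr /= -sumrB.
    have cardF : #|{ffun 'I_1 -> V}| = #|V| by rewrite card_ffun card_ord expn1.
    rewrite [n * _]mulr_natl -cardF -sumr_const -big_split /=.
    apply: eq_bigr => g _.
    by rewrite /D; ring.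
  move: (\sum_(g : {ffun 'I_1 -> V}) (extensions G g)%:R ^+ 2) S2 lo hi tri.
  move: (cliques G 2)%:R (cliques G 3)%:R => a2 a3 x2 S2 lo hi tri.
  have n30 : 0 < n ^+ 3 by rewrite exprn_gt0.
  have hi' : n * a2 <= n * ((p + zeta) * n ^+ 2) by rewrite ler_wpM2l // ltW.
  have lo' : 2 * p * n * ((p - zeta) * n ^+ 2) <= 2 * p * n * a2.
    by rewrite ler_wpM2l // mulr_ge0 ?mulr_ge0 // ltW.
  have pz : p * zeta * n ^+ 3 <= zeta * n ^+ 3.
    by rewrite ler_wpM2r ?(ltW n30) // ler_piMl.
  have H2 : 2 * (3 * zeta * n ^+ 3
     - (x2 - 2 * (p * n) * a2 + n * (p * n) ^+ 2)) >=
     4 * (zeta * n ^+ 3) - 4 * (p * zeta * n ^+ 3) + 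
     (n * a2 + a3 - 2 * x2) + (n * ((p + zeta) * n ^+ 2) - n * a2)
     + ((p * (2 * p - 1) + zeta) * n ^+ 3 - a3)
     + 2 * (2 * p * n * a2 - 2 * p * n * ((p - zeta) * n ^+ 2)).
    by rewrite le_eqVlt; apply/orP; left; apply/eqP; ring.
  lra.
have -> : 3 * zeta / eta ^+ 2 * n = 3 * zeta * n ^+ 3 / (eta * n) ^+ 2.
  by field; rewrite !gt_eqF.
rewrite ler_pdivlMr ?exprn_gt0 ?mulr_gt0 //; apply: le_trans var.
rewrite -sum1_card natr_sum mulr_suml [leLHS]big_mkcond.
apply: ler_sum => g _; rewrite inE mul1r /=; case: ifP => [low|_]; last exact: sqr_ge0.
have en : 0 < eta * n by rewrite mulr_gt0.
rewrite -[X in _ <= X]sqrrN ler_pXn2r ?nnegrE ?(ltW en) // /D; last lra.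
move: low; set x := _%:R; lra.
Qed.

(** By the conditions on degrees and on common neighbours almost every vertex
    misses exactly one entry of f, and by the last condition most of these
    form a regular tuple with the other entries. *)
Definition good (G : rel V) (p eta : R) (r : nat) (f : {ffun 'I_r -> V}) : bool :=
  [&& regular col f, cliqueb G f,
      [forall i, (p - eta) * n <= (extensions G (vertex_tuple (f i)))%:R],
      (extensions G f)%:R <= eta * n &
      [forall i, #|[pred v | cliqueb G (update f i v) &&
                            ~~ regular col (update f i v)]|%:R <= eta * n]].

(** Tuples with an entry of low degree are counted by that entry. The last two
    conditions fail for few tuples by Markov's inequality: the extensions of
    all r-cliques are the (r+1)-cliques, and an exchange at a given place
    leads to every irregular clique n times. *)
Lemma card_good (G : rel V) (p eta nu lam gam : R) (r : nat) : symmetric G ->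
  0 < eta ->
  #|[pred f : {ffun 'I_r -> V} | cliqueb G f && ~~ regular col f]|%:R
     <= nu * n ^+ r ->
  #|[pred g : {ffun 'I_1 -> V} | (extensions G g)%:R < (p - eta) * n]|%:R
     <= lam * n ->
  (cliques G r.+1)%:R <= gam * n ^+ r.+1 ->
  (cliques G r)%:R - (nu + r%:R * lam + gam / eta + r%:R * (nu / eta)) * n ^+ r
    <= #|[pred f : {ffun 'I_r -> V} | good G p eta f]|%:R.
Proof.
move=> Gsym e0 Hnu Hlam Hgam; have en : 0 < eta * n by rewrite mulr_gt0.
pose bad (f : {ffun 'I_r -> V}) i := #|[pred v | cliqueb G (update f i v) &&
                            ~~ regular col (update f i v)]|.
pose B2 (f : {ffun 'I_r -> V}) :=
  [exists i, (extensions G (vertex_tuple (f i)))%:R < (p - eta) * n].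
have H2 : #|[pred f | B2 f]|%:R <= r%:R * lam * n ^+ r.
  have := @card_cover_real R V 'I_1 'I_r lam
    (fun g => (extensions G g)%:R < (p - eta) * n) B2 V_gt0.
  rewrite !card_ord expr1; apply=> // f /existsP[i Hi].
  exists [ffun=> i]; first by move=> x y _; rewrite !ord1.
  by rewrite (_ : [ffun _ => _] = vertex_tuple (f i)) //; apply/ffunP=> x; rewrite !ffunE.
pose B3 (f : {ffun 'I_r -> V}) := cliqueb G f && (eta * n < (extensions G f)%:R).
have H3 : #|[pred f | B3 f]|%:R <= gam / eta * n ^+ r.
  have := @markov_count R _ (fun f : {ffun 'I_r -> V} => cliqueb G f)
    (extensions G (s:=r)) (gam * n ^+ r.+1) (eta * n) en.
  rewrite -cliquesS // => /(_ Hgam) /le_trans; apply.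
  by rewrite exprS le_eqVlt; apply/orP; left; apply/eqP; field; rewrite !gt_eqF.
pose B4 (f : {ffun 'I_r -> V}) i := eta * n < (bad f i)%:R.
have H4 i : #|[pred f | B4 f i]|%:R <= nu / eta * n ^+ r.
  have := @markov_count R _ (xpredT : pred {ffun 'I_r -> V})
    (fun f => bad f i) (n * (nu * n ^+ r)) (eta * n) en.
  rewrite (_ : n * (nu * n ^+ r) / (eta * n) = nu / eta * n ^+ r); last first.
    by field; rewrite !gt_eqF.
  apply; rewrite /bad (eq_bigr _ (fun f _ => card_pred_sum _)).
  rewrite (sum_update i (fun f => cliqueb G f && ~~ regular col f : nat)).
  by rewrite -card_pred_sum natrM; apply: ler_wpM2l Hnu; exact: ltW n_gt0.
have cover : (cliques G r <= #|[pred f : {ffun 'I_r -> V} | good G p eta f]|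
   + #|[pred f : {ffun 'I_r -> V} | cliqueb G f && ~~ regular col f]|
   + #|[pred f | B2 f]| + #|[pred f | B3 f]| + \sum_i #|[pred f | B4 f i]|)%N.
  rewrite /cliques !card_pred_sum (eq_bigr _ (fun i _ => card_pred_sum _)).
  rewrite exchange_big -!big_split /=; apply: leq_sum => f _.
  rewrite /good /B3; case: (boolP (cliqueb G f)) => //= Cf.
  case: (boolP (regular col f)) => /= rf; last by rewrite !addn_gt0.
  case: (boolP (B2 f)) => /= [_|nB2]; first by rewrite !addn_gt0 orbT.
  rewrite (_ : [forall i, _] = true) /=; last first.
    move: nB2; rewrite negb_exists => /forallP H; apply/forallP => i.
    by rewrite leNgt.
  case: leP => /= _; last by rewrite !addn_gt0.
  rewrite !addn0; set q := [forall i, _]; case Eq: q; first by [].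
  move/negbT: Eq; rewrite negb_forall => /existsP[i Hi]; rewrite (bigD1 i) //=.
  by rewrite {1}/B4 ltNge Hi !addn_gt0 orbT.
move: cover; rewrite -(ler_nat R) !natrD natr_sum => cover.
have H4' : \sum_(i < r) #|[pred f | B4 f i]|%:R <= r%:R * (nu / eta) * n ^+ r.
  apply: (@le_trans _ _ (\sum_(i < r) nu / eta * n ^+ r)).
    by apply: ler_sum => i _; exact: H4.
  by rewrite sumr_const card_ord -[X in X <= _]mulr_natl mulrA.
rewrite !mulrDl; lra.
Qed.

(** Vertices with two missing neighbours in f lower the total degree below
    r - 1 per vertex, and only common neighbours raise it. *)
Lemma sum_degrees_le (G : rel V) (r : nat) (f : {ffun 'I_r -> V}) :
  (\sum_i extensions G (vertex_tuple (f i))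
     + #|[pred v | 1 < #|[pred i | ~~ G (f i) v]| ]| + #|V|
   <= r * #|V| + extensions G f)%N.
Proof.
rewrite (eq_bigr _ (fun i _ => extensions_vertex G (f i))).
rewrite (eq_bigr _ (fun i _ => card_pred_sum _)) exchange_big card_pred_sum.
rewrite /extensions card_pred_sum mulnC -sum_nat_const -[X in (_ + X <= _)%N]sum1_card.
rewrite -!big_split /=; apply: leq_sum => v _; rewrite -card_pred_sum.
have E : (#|[pred i | G (f i) v]| + #|[pred i | ~~ G (f i) v]| = r)%N.
  rewrite -[RHS](card_ord r) -(cardC [pred i | G (f i) v]).
  by congr addn; exact: eq_card.
have : #|[pred i | ~~ G (f i) v]| = 0%N -> joined G f v.
  move=> /card0_eq H; apply/forallP => i; have := H i.
  by rewrite inE => /negbFE.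
move: E; move: #|[pred i | G (f i) v]| #|[pred i | ~~ G (f i) v]| (joined G f v).
move=> a [|[|b]] J <- H.
- by rewrite H // !addn0.
- by rewrite addn0 leq_addr.
by rewrite -addnA (leq_trans _ (leq_addr _ _)) // leq_add2l.
Qed.

(** Two transversals with two entries in common have the same colour, and
    with three parts one entry of a pair can be changed at a time. *)
Lemma regular_box_colour (r : nat) (W : 'I_r -> 'I_3 -> V) : (3 <= r)%N ->
  (forall a : {ffun 'I_r -> 'I_3}, regular col [ffun i => W i (a i)]) ->
  exists l, forall i j a b, i != j -> col (W i a) (W j b) = l.
Proof.
move=> r3 HW.
have swap i j m a b e : i != j -> i != m -> j != m ->
    col (W i a) (W j b) = col (W i a) (W m e).
  move=> ij im jm.
  pose x := [ffun t => if t == i then a else if t == j then b else e].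
  have /regularP[_ H] := HW x; have := H i j i m ij im.
  by rewrite !ffunE eqxx ![_ == i]eq_sym (negbTE ij) (negbTE im) eqxx
    [m == j]eq_sym (negbTE jm).
have swap1 i j a b b' : i != j -> col (W i a) (W j b) = col (W i a) (W j b').
  move=> ij; have [m mi mj] := third_index i j r3.
  rewrite (swap i j m a b ord0) // 1?eq_sym // (swap i m j a ord0 b') //.
  by rewrite eq_sym.
have base i j a b : i != j -> col (W i a) (W j b) = col (W i ord0) (W j ord0).
  move=> ij; rewrite (swap1 i j a b ord0 ij) col_sym.
  by rewrite (swap1 j i ord0 a ord0) 1?eq_sym // col_sym.
have h0 : (0 < r)%N by lia.
have h1 : (1 < r)%N by lia.
exists (col (W (Ordinal h0) ord0) (W (Ordinal h1) ord0)) => i j a b ij.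
rewrite base //; have /regularP[_ H] := HW [ffun=> ord0].
by have := H i j (Ordinal h0) (Ordinal h1) ij isT; rewrite !ffunE.
Qed.

(** The vertices not adjacent to a point of the j-th part make up about one
    r-th of all. Apart from the few that miss a second neighbour, or that
    produce an irregular clique when put in the j-th place, they are at the
    common distance from all points of the other parts. *)
Lemma large_parts (G : rel V) (eta : R) (r : nat) (W : 'I_r -> 'I_3 -> V) :
  symmetric G -> (3 <= r)%N -> 0 < eta ->
  (forall a : {ffun 'I_r -> 'I_3}, good G (1 - r%:R^-1) eta [ffun i => W i (a i)]) ->
  exists l, (forall i j a b, i != j -> col (W i a) (W j b) = l) /\
    forall j, (r%:R^-1 - (4 * r%:R + 6) * eta) * n <=
      #|[pred v | [forall i, forall a, (i != j) ==> (col v (W i a) == l)]]|%:R.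
Proof.
move=> Gsym r3 e0 HW.
have [a|l Hl] := regular_box_colour r3 (W := W).
  by case/and5P: (HW a).
exists l; split=> // j; set p := 1 - _ in HW.
pose tau (a : 'I_3) : {ffun 'I_r -> V} :=
  [ffun i => W i ([ffun i' => if i' == j then ord0 else a] i)].
have tauE a i : tau a i = W i (if i == j then ord0 else a) by rewrite !ffunE.
have good_tau a : good G p eta (tau a) by exact: HW.
pose B v := [forall i, forall a, (i != j) ==> (col v (W i a) == l)].
pose M a v := (1 < #|[pred i | ~~ G (tau a i) v]|)%N.
pose I a v := cliqueb G (update (tau a) j v) && ~~ regular col (update (tau a) j v).
have cover : (#|V| <= extensions G (vertex_tuple (W j ord0))
     + \sum_a (#|[pred v | M a v]| + #|[pred v | I a v]|) + #|[pred v | B v]|)%N.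
  rewrite extensions_vertex -sum1_card !card_pred_sum.
  under [X in (_ <= _ + X + _)%N]eq_bigr => a _ do rewrite !card_pred_sum -big_split.
  rewrite exchange_big -!big_split /=; apply: leq_sum => v _.
  case: (boolP (G (W j ord0) v)) => // nG; rewrite add0n.
  case: (posnP (\sum_a (M a v + I a v))%N) => [|pos]; last by rewrite addn_gt0 pos.
  move=> /eqP; rewrite sum_nat_eq0 => /forallP noMI.
  suff -> : B v by rewrite addn_gt0 orbT.
  apply/forallP=> i; apply/forallP => a; apply/implyP => ij.
  have := noMI a; rewrite /= addn_eq0 !eqb0 => /andP[nM].
  case/and5P: (good_tau a) => _ /cliqueP Ctau _ _ _.
  have adj i' : i' != j -> G (tau a i') v.
    move=> i'j; apply: contraNT nM => nGi'; apply/card_gt1P.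
    by exists i', j; rewrite !inE nGi' tauE eqxx.
  rewrite /I negb_and negbK => /orP[/negP[]|/regularP[_ reg]].
    apply/cliqueP => x y xy; rewrite ![update _ _ _ _]ffunE.
    have [xj|xj] := eqVneq x j; have [yj|yj] := eqVneq y j.
    - by rewrite xj yj eqxx in xy.
    - by rewrite Gsym adj.
    - exact: adj.
    - exact: Ctau.
  have [m mi mj] := third_index i j r3.
  have := reg j i i m; rewrite [j == i]eq_sym ij [i == m]eq_sym mi => /(_ isT isT).
  rewrite ![update _ _ _ _]ffunE eqxx (negbTE ij) (negbTE mj) !tauE.
  by rewrite (negbTE ij) (negbTE mj) => ->; rewrite Hl // eq_sym.
have r0 : r%:R != 0 :> R by rewrite pnatr_eq0; case: (r) r3.
have rp : r%:R * p = r%:R - 1 by rewrite /p mulrBr mulr1 divff.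
pose deg a i : R := (extensions G (vertex_tuple (tau a i)))%:R - (p - eta) * n.
have deg_ge0 a i : 0 <= deg a i.
  by rewrite subr_ge0; case/and5P: (good_tau a) => _ _ /forallP/(_ i).
have key a : \sum_i deg a i + #|[pred v | M a v]|%:R <= (r%:R + 1) * (eta * n).
  have := sum_degrees_le G (tau a); rewrite -(ler_nat R) !natrD natrM natr_sum -/n.
  case/and5P: (good_tau a) => _ _ _ He _.
  rewrite sumrB sumr_const card_ord -[_ * n *+ r]mulr_natl /M.
  have -> : r%:R * ((p - eta) * n) = r%:R * n - n - r%:R * (eta * n).
    by rewrite mulrA mulrBr rp; ring.
  rewrite mulrDl mul1r; lra.
have degj : (extensions G (vertex_tuple (W j ord0)))%:R
    <= p * n + r%:R * (eta * n).
  have := key ord0; rewrite (bigD1 j) //= {1}/deg tauE eqxx.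
  have : 0 <= \sum_(i | i != j) deg ord0 i by exact: sumr_ge0.
  have := ler0n R #|[pred v | M ord0 v]|; rewrite mulrBl (mulrDl r%:R 1) mul1r; lra.
have missed a : (#|[pred v | M a v]| + #|[pred v | I a v]|)%:R
    <= (r%:R + 2) * (eta * n).
  case/and5P: (good_tau a) => _ _ _ _ /forallP/(_ j); rewrite -/(I a) natrD.
  have := key a; have : 0 <= \sum_i deg a i by exact: sumr_ge0.
  rewrite !(mulrDl r%:R) mul1r /I; lra.
have missed_sum : (\sum_a (#|[pred v | M a v]| + #|[pred v | I a v]|))%:R
    <= 3 * ((r%:R + 2) * (eta * n)).
  rewrite natr_sum; apply: le_trans (ler_sum _ (fun a _ => missed a)) _.
  by rewrite sumr_const card_ord mulr_natl.
move: cover; rewrite -(ler_nat R) !natrD -/n /B => cover.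
have -> : (r%:R^-1 - (4 * r%:R + 6) * eta) * n =
   n - (p * n + r%:R * (eta * n)) - 3 * ((r%:R + 2) * (eta * n)).
  by rewrite /p; ring.
lra.
Qed.

End GoodTuples.

(** * The combinatorial stability theorem *)

(** Triples of points such that the colour between points of two different
    triples depends only on the two triples. *)
Definition has_box (R : realType) (V : finType) (col : V -> V -> R) (m : nat) :
    Prop :=
  exists2 W : 'I_m -> 'I_3 -> V, forall i, injective (W i) &
    forall i j a b, i != j -> col (W i a) (W j b) = col (W i ord0) (W j ord0).

Lemma turan2 (R : realType) (r : nat) : turan R r 2 = 1 - r%:R^-1.
Proof. by rewrite turan_split big_ord0 mul1r. Qed.

Lemma turan3 (R : realType) (r : nat) :
  turan R r 3 = (1 - r%:R^-1) * (2 * (1 - r%:R^-1) - 1).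
Proof. by rewrite turanS turan2; congr (_ * _); ring. Qed.

(** Once the apexes are fixed, a box of cliques has all its colours constant:
    two entries of different parts have the colour of either of them with the
    apex of the two parts, so neither can influence it. *)
Lemma few_rich_cliques (R : realType) (m : nat) (d g : R) :
  0 < d <= 1 -> 0 < g ->
  exists n0 : nat, forall (V : finType) (col : V -> V -> R),
    (n0 <= #|V|)%N -> ~ has_box col m ->
    clique_density R (rich col d) m <= g.
Proof.
move=> d01 g0; have /andP[d0 _] := d01.
have c0 : 0 < g * d ^+ #|{: 'I_m * 'I_m}| by rewrite mulr_gt0 ?exprn_gt0.
have [n0 Hn0] := box_theorem m c0.
exists (maxn n0 1) => V col; rewrite geq_max => /andP[Vn0 V0] nobox.
rewrite leNgt; apply/negP => lt_g; apply: nobox.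
have n0' : 0 < #|V|%:R :> R by rewrite ltr0n.
have many : g * #|V|%:R ^+ m <= (cliques (rich col d) m)%:R.
  by rewrite -ler_pdivlMr ?exprn_gt0 //; exact: ltW.
have [z Hz] := common_apexes V0 d01 g0 many.
have [W Winj HW] := Hn0 _ _ Vn0 Hz.
exists W => // i j a b ij.
have apex a' b' : equilateral col (W i a') (W j b') (z (i, j)).
  have /forallP/(_ (i, j))/implyP/(_ ij) := HW [ffun t => if t == i then a' else b'].
  by rewrite !ffunE /= eqxx [j == i]eq_sym (negbTE ij).
have /and5P[_ _ _ /eqP E1 /eqP E2] := apex a b.
have /and5P[_ _ _ /eqP F1 /eqP F2] := apex a ord0.
have /and5P[_ _ _ /eqP G1 /eqP G2] := apex ord0 ord0.
by rewrite E1 -F1 F2 G2.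
Qed.

(** The hypotheses put the density of k-cliques of the graph of rich pairs
    close to its maximum for graphs with few (r+1)-cliques. Hence the degrees
    concentrate, r-cliques are dense and irregular ones rare, so that a
    positive proportion of the r-tuples is good; any box of good tuples has
    large parts. *)
Lemma combinatorial_stability (R : realType) (r k : nat) (eta : R) :
  (3 <= k)%N -> (k <= r)%N -> 0 < eta ->
  exists2 gamma : R, 0 < gamma & exists n0 : nat,
  forall (V : finType) (col : V -> V -> R), (forall x y, col x y = col y x) ->
    (n0 <= #|V|)%N -> ~ has_box col r.+1 ->
    (turan R r k - gamma) * #|V|%:R ^+ k
      <= #|[pred f : {ffun 'I_k -> V} | regular col f]|%:R ->
  exists (W : 'I_r -> 'I_3 -> V) (l : R),
    [/\ forall i, injective (W i),
        forall i j a b, i != j -> W i a != W j b /\ col (W i a) (W j b) = l &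
        forall j, (r%:R^-1 - eta) * #|V|%:R <=
          #|[pred v | [forall i, forall a, (i != j) ==> (col v (W i a) == l)]]|%:R].
Proof.
move=> k3 kr eta0.
have r3 : (3 <= r)%N by apply: leq_trans kr.
have k0 : 0 < k%:R :> R by rewrite ltr0n; apply: leq_trans k3.
have r0 : 0 < r%:R :> R by rewrite ltr0n; apply: leq_trans r3.
(* the parts obtained from good tuples fall short by (4 r + 6) e n *)
pose e := eta / (4 * r%:R + 6).
have e0 : 0 < e by rewrite divr_gt0 // addr_gt0 // mulr_gt0.
pose c : R := (2 * r%:R)^-1 ^+ r.
have c0 : 0 < c by rewrite exprn_gt0 // invr_gt0 mulr_gt0.
pose A : R := r%:R ^+ k; have A0 : 0 < A by rewrite exprn_gt0.
(* the loss in the count of good tuples is at most K zeta *)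
pose K : R := 3 * A + r%:R * (3 / e ^+ 2) + e^-1 + r%:R * (3 * A / e).
have K0 : 0 < K.
  by rewrite !addr_gt0 ?mulr_gt0 ?invr_gt0 ?exprn_gt0.
(* by the first bound r-cliques are dense, by the second half of them are good *)
pose zeta := Num.min (2 * r%:R ^+ 2)^-1 (c / 2 / K).
have zeta0 : 0 < zeta 
  by rewrite lt_min !divr_gt0 // invr_gt0 mulr_gt0 // exprn_gt0.
have k2 : (2 <= k)%N by apply: leq_trans k3.
have [g1 g10 Hstab] := density_stability k2 kr zeta0.
pose g := Num.min g1 zeta.
have g0 : 0 < g by rewrite lt_min g10.
have gz : g <= zeta by rewrite ge_min lexx orbT.
have gg1 : g <= g1 by rewrite ge_min lexx.
pose d := Num.min 1 (g / 2 / k%:R ^+ 3).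
have d0 : 0 < d by rewrite lt_min ltr01 !divr_gt0 ?exprn_gt0.
have d1 : d <= 1 by rewrite ge_min lexx.
have dk : k%:R ^+ 3 * d <= g / 2.
  by rewrite mulrC -ler_pdivlMr ?exprn_gt0 // ge_min lexx orbT.
have d01 : 0 < d <= 1 by rewrite d0.
have [n1 Hn1] := few_rich_cliques r.+1 d01 g0.
have c20 : 0 < c / 2 by rewrite divr_gt0.
have [n2 Hn2] := box_theorem r c20.
exists (g / 2); first by rewrite divr_gt0.
exists (maxn 1 (maxn n1 n2)) => V col col_sym.
rewrite !geq_max => /and3P[V0 Vn1 Vn2] nobox Hreg.
set n : R := #|V|%:R; have n0 : 0 < n by rewrite ltr0n.
pose G := rich col d; have Gsym : symmetric G by exact: rich_sym.
have dens := density_seq_cliques R V0 Gsym.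
have ar1 : clique_density R G r.+1 <= g by exact: Hn1.
have split_reg : (#|[pred f : {ffun 'I_k -> V} | regular col f]| =
    #|[pred f : {ffun 'I_k -> V} | cliqueb G f && regular col f]| +
    #|[pred f : {ffun 'I_k -> V} | regular col f && ~~ cliqueb G f]|)%N.
  rewrite !card_pred_sum -big_split /=; apply: eq_bigr => f _.
  by case: (regular col f); case: (cliqueb G f).
have split_clq : (cliques G k =
    #|[pred f : {ffun 'I_k -> V} | cliqueb G f && regular col f]| +
    #|[pred f : {ffun 'I_k -> V} | cliqueb G f && ~~ regular col f]|)%N.
  rewrite /cliques !card_pred_sum -big_split /=; apply: eq_bigr => f _.
  by case: (regular col f); case: (cliqueb G f).
have Hpoor := card_regular_not_clique col V0 k3 (ltW d0).
have nk0 : 0 < n ^+ k by rewrite exprn_gt0.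
have Hpoor' : #|[pred f : {ffun 'I_k -> V} | regular col f && ~~ cliqueb G f]|%:R
    <= g / 2 * n ^+ k.
  by apply: le_trans Hpoor _; rewrite ler_wpM2r // ltW.
have lo_k : (turan R r k - g) * n ^+ k <=
    #|[pred f : {ffun 'I_k -> V} | cliqueb G f && regular col f]|%:R.
  by move: Hreg; rewrite split_reg natrD -/n !mulrBl; lra.
have ak : turan R r k - g <= clique_density R G k.
  rewrite ler_pdivlMr //; apply: le_trans lo_k _.
  by rewrite split_clq natrD lerDl.
have [a2 up] := Hstab _ dens (le_trans ar1 gg1)
  (le_trans (lerB (lexx _) gg1) ak).
have irr_k : #|[pred f : {ffun 'I_k -> V} | cliqueb G f && ~~ regular col f]|%:R
    <= (2 * zeta) * n ^+ k.
  have := up k kr; rewrite ler_pdivrMr // split_clq natrD.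
  have := lo_k; have : g * n ^+ k <= zeta * n ^+ k by rewrite ler_wpM2r // ltW.
  by rewrite -/n !mulrDl !mulNr -mulrA; lra.
have kr' : (3 <= k <= r)%N by rewrite k3.
have irr_r := card_irregular_cliques col_sym V0 kr' irr_k.
have r2 : (2 <= r)%N by apply: leq_trans r3.
have low : #|[pred h : {ffun 'I_1 -> V} |
     (extensions G h)%:R < (1 - r%:R^-1 - e) * n]|%:R <= 3 * zeta / e ^+ 2 * n.
  apply: card_low_degree => //; last 2 first.
  - by rewrite a2 /= -turan2; exact: up.
  - by rewrite -turan3; exact: up.
  - by have := turan_factor_ge0 R (ltnW r2) (ltnW r2);
      rewrite mul1r => ->; rewrite lerBlDr lerDl invr_ge0 ltW.
  - exact: ltW.
have cr1 : (cliques G r.+1)%:R <= g * n ^+ r.+1.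
  by rewrite -ler_pdivrMr ?exprn_gt0.
have ar : c <= clique_density R G r.
  apply: density_cliques_lb => //; apply: le_trans a2.
  by rewrite lerD2l lerN2 ge_min lexx.
have := card_good V0 Gsym e0 irr_r low cr1.
set loss := (X in X * _) => Hgood.
have Hloss : loss <= c / 2.
  apply: (@le_trans _ _ (K * zeta)); last first.
    by rewrite mulrC -ler_pdivlMr // ge_min lexx orbT.
  have ez : g / e <= e^-1 * zeta by rewrite mulrC ler_wpM2l // invr_ge0 ltW.
  have Az : 0 <= A * zeta by rewrite mulr_ge0 ?ltW.
  have Aze : 0 <= r%:R * (A * zeta / e) 
    by rewrite ltW // mulr_gt0 // divr_gt0 // mulr_gt0.
  have -> : loss = A * zeta * 2 + r%:R * (3 / e ^+ 2) * zeta + g / e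
     + r%:R * (A * zeta / e) * 2 by rewrite /loss -/A; field; rewrite gt_eqF.
  have -> : K * zeta = A * zeta * 3 + r%:R * (3 / e ^+ 2) * zeta + e^-1 * zeta
     + r%:R * (A * zeta / e) * 3 by rewrite /K; field; rewrite gt_eqF.
  lra.
have nr0 : 0 < n ^+ r by rewrite exprn_gt0.
have many : c / 2 * n ^+ r <=
    #|[pred f : {ffun 'I_r -> V} | good col G (1 - r%:R^-1) e f]|%:R.
  apply: le_trans Hgood; rewrite -/n.
  have : c * n ^+ r <= (cliques G r)%:R by rewrite -ler_pdivlMr.
  have : loss * n ^+ r <= c / 2 * n ^+ r by rewrite ler_wpM2r // ltW.
  lra.
have [W Winj HW] := Hn2 _ _ Vn2 many.
have [l [Hl Hpart]] := large_parts V0 col_sym Gsym r3 e0 HW.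
exists W, l; split=> // [i j a b ij|j].
  split; last exact: Hl.
  have /and5P[_ /cliqueP Cf _ _ _] := HW [ffun t => if t == i then a else b].
  have := Cf i j ij; rewrite !ffunE eqxx [j == i]eq_sym (negbTE ij).
  exact: rich_neq.
apply: le_trans (Hpart j); rewrite ler_wpM2r ?(ltW n0) //.
by rewrite /e mulrC divfK // gt_eqF // addr_gt0 // mulr_gt0.
Qed.

(** * Three-point sets at constant distance from one another *)

Section Geometry.
Variables (R : realType) (d : nat).
Implicit Types (u v x y : 'rV[R]_d).

Lemma edotC u v : edot u v = edot v u.
Proof. by apply: eq_bigr => i _; rewrite mulrC. Qed.

Lemma edotDl u u' v : edot (u + u') v = edot u v + edot u' v.
Proof. by rewrite /edot -big_split /=; apply: eq_bigr => i _; rewrite mxE mulrDl. Qed.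

Lemma edotZl a u v : edot (a *: u) v = a * edot u v.
Proof. by rewrite /edot big_distrr /=; apply: eq_bigr => i _; rewrite mxE mulrA. Qed.

Lemma edotNl u v : edot (- u) v = - edot u v.
Proof. by rewrite -scaleN1r edotZl mulN1r. Qed.

Lemma edotBl u u' v : edot (u - u') v = edot u v - edot u' v.
Proof. by rewrite edotDl edotNl. Qed.

Lemma edotBr u v v' : edot u (v - v') = edot u v - edot u v'.
Proof. by rewrite edotC edotBl !(edotC _ u). Qed.

Lemma edotZr a u v : edot u (a *: v) = a * edot u v.
Proof. by rewrite edotC edotZl edotC. Qed.

Lemma edot0l v : edot 0 v = 0.
Proof. by rewrite -(scale0r v) edotZl mul0r. Qed.

Lemma edot_suml (I : finType) (F : I -> 'rV[R]_d) v :
  edot (\sum_i F i) v = \sum_i edot (F i) v.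
Proof.
by apply: (big_morph (fun u => edot u v)) => [u u'|]; rewrite ?edotDl ?edot0l.
Qed.

Lemma edot_ge0 u : 0 <= edot u u.
Proof. by apply: sumr_ge0 => i _; rewrite -expr2 sqr_ge0. Qed.

Lemma edot_eq0 u : edot u u = 0 -> u = 0.
Proof.
move=> /eqP; rewrite psumr_eq0 => [/allP H|i _]; last by rewrite -expr2 sqr_ge0.
apply/rowP => i; have := H i; rewrite mem_index_enum mxE => /(_ isT).
by rewrite mulf_eq0 orbb => /eqP.
Qed.

Lemma edistC x y : edist x y = edist y x.
Proof. by rewrite /edist -(opprB y x) edotNl edotC edotNl opprK. Qed.

Lemma edist_ge0 x y : 0 <= edist x y.
Proof. exact: sqrtr_ge0. Qed.

Lemma edist_sqr x y : edist x y ^+ 2 = edot (x - y) (x - y).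
Proof. by rewrite sqr_sqrtr // edot_ge0. Qed.

Lemma edist_gt0 x y : x != y -> 0 < edist x y.
Proof.
move=> xy; rewrite lt_neqAle edist_ge0 andbT eq_sym; apply/eqP => E.
have := edist_sqr x y; rewrite E expr0n /= => /esym/edot_eq0/eqP.
by rewrite subr_eq0 (negbTE xy).
Qed.

Definition plane_of (w : 'I_3 -> 'rV[R]_d) : {vspace 'rV[R]_d} :=
  <<[:: w (lift ord0 ord0) - w ord0; w ord_max - w ord0]>>%VS.

Lemma plane_ofP w u : u \in plane_of w ->
  exists s t, u = s *: (w (lift ord0 ord0) - w ord0) + t *: (w ord_max - w ord0).
Proof.
rewrite /plane_of span_cons span_seq1 => /memv_addP[a /vlineP[s ->]].
by case=> b /vlineP[t ->] ->; exists s, t.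
Qed.

Lemma edot_plane0 w v : (forall a, edot (w a - w ord0) v = 0) ->
  forall u, u \in plane_of w -> edot u v = 0.
Proof.
by move=> H u /plane_ofP[s [t ->]]; rewrite edotDl !edotZl !H !mulr0 addr0.
Qed.

(** The difference of two of the equations |x - w a|^2 = l^2 is a linear
    equation for x in which only the points w a occur. *)
Lemma equidistant_orthogonal w x y (l : R) :
  (forall a, edist x (w a) = l) -> (forall a, edist y (w a) = l) ->
  forall u, u \in plane_of w -> edot u (x - y) = 0.
Proof.
move=> Hx Hy; apply: edot_plane0 => a.
have := congr1 (fun t => t ^+ 2) (Hx a); have := congr1 (fun t => t ^+ 2) (Hy a).
have := congr1 (fun t => t ^+ 2) (Hx ord0).
have := congr1 (fun t => t ^+ 2) (Hy ord0).
rewrite /= !edist_sqr !(edotBl, edotBr); have := (edotC x (w a), edotC y (w a)).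
have := (edotC x (w ord0), edotC y (w ord0)) => -[-> ->] [-> ->]; lra.
Qed.

Lemma planes_orthogonal w w' (l : R) :
  (forall a b, edist (w a) (w' b) = l) ->
  forall u v, u \in plane_of w -> v \in plane_of w' -> edot u v = 0.
Proof.
move=> H u v Hu Hv; apply: edot_plane0 Hu => a; rewrite edotC.
apply: (equidistant_orthogonal (w := w') (l := l)) Hv => b; exact: H.
Qed.

(** A line meets a sphere in at most two points. *)
Lemma dim_plane_of w x (l : R) : injective w ->
  (forall a, edist x (w a) = l) -> \dim (plane_of w) = 2%N.
Proof.
move=> winj Hx; set e1 := w (lift ord0 ord0) - w ord0.
set e2 := w ord_max - w ord0.
have e1n0 : e1 != 0 by rewrite subr_eq0 (inj_eq winj).
have e2n0 : e2 != 0 by rewrite subr_eq0 (inj_eq winj).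
have e12 : e1 != e2 by rewrite (inj_eq (addIr _)) (inj_eq winj).
suff /eqP : free [:: e1; e2] by [].
rewrite free_cons seq1_free e2n0 andbT span_seq1; apply/negP => /vlineP[t E].
have Q a : edot (w a - w ord0) (w a - w ord0) = 2 * edot (w a - w ord0) (x - w ord0).
  have := congr1 (fun t => t ^+ 2) (Hx a).
  have := congr1 (fun t => t ^+ 2) (Hx ord0).
  rewrite /= !edist_sqr !(edotBl, edotBr).
  have := (edotC x (w a), edotC x (w ord0), edotC (w ord0) (w a)).
  move=> [[-> ->] ->]; lra.
have := Q (lift ord0 ord0); have := Q ord_max; rewrite -/e1 -/e2 E.
rewrite !edotZl edotZr => Q2 Q1.
have : t * (t - 1) * edot e2 e2 = 0.
  by rewrite mulrBr mulr1 mulrBl -mulrA Q1 Q2; ring.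
move/eqP; rewrite !mulf_eq0 subr_eq0 => /orP[/orP[]/eqP t01|/eqP/edot_eq0/eqP].
- by move: e1n0; rewrite E t01 scale0r eqxx.
- by move: e12; rewrite E t01 scale1r eqxx.
- by rewrite (negbTE e2n0).
Qed.

Definition orthogonal_family (m : nat) (U : 'I_m -> {vspace 'rV[R]_d}) : Prop :=
  forall i j u v, i != j -> u \in U i -> v \in U j -> edot u v = 0.

Lemma dim_orthogonal_sum (m : nat) (U : 'I_m -> {vspace 'rV[R]_d}) :
  orthogonal_family U -> \dim (\sum_i U i)%VS = (\sum_i \dim (U i))%N.
Proof.
move=> orth; apply/directvP/directv_sum_independent => us Hus sum0 i _.
apply: edot_eq0; rewrite -[RHS](edot0l (us i)) -sum0 edot_suml.
rewrite (bigD1 i) //= big1 ?addr0 // => j ji.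
exact: orth (Hus j isT) (Hus i isT).
Qed.

Lemma orthogonal_decomposition (m : nat) (U : 'I_m -> {vspace 'rV[R]_d}) x :
  (\sum_i U i)%VS = fullv ->
  exists2 y : 'I_m -> 'rV[R]_d, forall i, y i \in U i & x = \sum_i y i.
Proof.
move=> full; have : x \in (\sum_i U i)%VS by rewrite full memvf.
by case/memv_sumP => y Hy ->; exists y => // i; exact: Hy.
Qed.

Lemma edot_component (m : nat) (U : 'I_m -> {vspace 'rV[R]_d})
    (y : 'I_m -> 'rV[R]_d) i u :
  orthogonal_family U -> (forall j, y j \in U j) -> u \in U i ->
  edot (\sum_j y j) u = edot (y i) u.
Proof.
move=> orth Hy Hu; rewrite edot_suml (bigD1 i) //= big1 ?addr0 // => j ji.
exact: orth (Hy j) Hu.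
Qed.

Lemma mem_orthogonal_complement (m : nat) (U : 'I_m -> {vspace 'rV[R]_d}) x j :
  orthogonal_family U -> (\sum_i U i)%VS = fullv ->
  (forall i u, i != j -> u \in U i -> edot x u = 0) -> x \in U j.
Proof.
move=> orth full H; have [y Hy xy] := orthogonal_decomposition x full.
suff -> : x = y j by [].
rewrite xy (bigD1 j) //= big1 ?addr0 // => i ij; apply: edot_eq0.
by rewrite -(edot_component orth Hy (Hy i)) -xy (H i _ ij (Hy i)).
Qed.

End Geometry.

(** Each part spans a plane, and the planes of different parts are
    orthogonal: there is room for at most r of them. *)
Lemma no_large_box (R : realType) (r : nat) (X : {fset 'rV[R]_(2 * r)}) :
  (0 < r)%N ->
  ~ has_box (fun x y : X => edist (val x) (val y)) r.+1.
Proof.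
move=> r0 [W Winj HW]; pose w i a := val (W i a).
have winj i : injective (w i) by move=> a b /val_inj/Winj.
have dist i j a b : i != j -> edist (w i a) (w j b) = edist (w i ord0) (w j ord0).
  exact: HW.
pose U i := plane_of (w i).
have orth : orthogonal_family U.
  move=> i j u v ij.
  apply: (planes_orthogonal (l := edist (w i ord0) (w j ord0))) => a b.
  exact: dist.
have dimU i : \dim (U i) = 2%N.
  have [j ji] : exists j, j != i.
    have [->|ni] := eqVneq i ord0; last by exists ord0; rewrite eq_sym.
    by exists ord_max; rewrite -val_eqE /= -lt0n.
  apply: (dim_plane_of (x := w j ord0) (l := edist (w j ord0) (w i ord0))) => // a.
  exact: dist.
have := dimvS (subvf (\sum_i U i)%VS).
rewrite dim_orthogonal_sum // (eq_bigr _ (fun i _ => dimU i)).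
rewrite sum_nat_const card_ord dimvf /dim /= mul1n; lia.
Qed.

(** The planes of the r parts fill the space. The points at distance l from
    the i-th part project to one and the same point of the i-th plane, and
    the sum c of these projections is the centre. A point at distance l from
    all parts but the j-th then lies in the plane through c of the j-th
    part, and by Pythagoras, with three parts at hand, at distance
    l / sqrt 2 from c. *)
Lemma box_circles (R : realType) (r : nat) (w : 'I_r -> 'I_3 -> 'rV[R]_(2 * r))
    (l : R) :
  (3 <= r)%N -> (forall i, injective (w i)) -> 0 < l ->
  (forall i j a b, i != j -> edist (w i a) (w j b) = l) ->
  exists (c : 'rV[R]_(2 * r)) (g : R) (U : 'I_r -> {vspace 'rV[R]_(2 * r)}),
    [/\ 0 < g, forall i, \dim (U i) = 2%N, orthogonal_family U &
        forall j x, (forall i a, i != j -> edist x (w i a) = l) ->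
          x - c \in U j /\ edist x c = g].
Proof.
move=> r3 winj l0 dist; pose U i := plane_of (w i).
have orth : orthogonal_family U.
  by move=> i j u v ij; apply: (planes_orthogonal (l := l)) => a b; exact: dist.
have other i : exists j : 'I_r, j != i.
  by have [j ji _] := third_index i i r3; exists j.
have dimU i : \dim (U i) = 2%N.
  have [j ji] := other i.
  by apply: (dim_plane_of (x := w j ord0) (l := l)) => // a; exact: dist.
have full : (\sum_i U i)%VS = fullv.
  apply/eqP; rewrite -(geq_leqif (dimv_leqif_eq (subvf _))).
  rewrite dim_orthogonal_sum // (eq_bigr _ (fun i _ => dimU i)).
  by rewrite sum_nat_const card_ord dimvf /dim /= mul1n mulnC.
have proj i : exists y, y \in U i /\ forall x, (forall a, edist x (w i a) = l) ->
    forall u, u \in U i -> edot x u = edot y u.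
  have [j ji] := other i.
  have [y Hy xy] := orthogonal_decomposition (w j ord0) full.
  exists (y i); split=> // x Hx u Hu; rewrite -(edot_component orth Hy Hu) -xy.
  apply/eqP; rewrite -subr_eq0 -edotBl edotC; apply/eqP.
  by apply: (equidistant_orthogonal (w := w i) (l := l)) => // a; exact: dist.
have [y Hy] := fin_all_exists proj.
pose c := \sum_i y i.
have center i x u : (forall a, edist x (w i a) = l) -> u \in U i ->
    edot (x - c) u = 0.
  move=> Hx Hu; rewrite edotBl /c (edot_component orth _ Hu).
    by rewrite (proj2 (Hy i) x Hx u Hu) subrr.
  by move=> j; exact: (proj1 (Hy j)).
have inU j x : (forall i a, i != j -> edist x (w i a) = l) -> x - c \in U j.
  move=> Hx; apply: (mem_orthogonal_complement orth full) => i u ij Hu.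
  by apply: center Hu => a; exact: Hx.
have wU j a : w j a - c \in U j.
  by apply: inU => i b ij; apply: dist; rewrite eq_sym.
pose q i := edot (w i ord0 - c) (w i ord0 - c).
have pyth i j x : i != j -> x - c \in U j -> edist x (w i ord0) = l ->
    edot (x - c) (x - c) + q i = l ^+ 2.
  move=> ij Hx <-; rewrite edist_sqr.
  have -> : x - w i ord0 = (x - c) - (w i ord0 - c) by rewrite opprB addrA subrK.
  have H0 : edot (w i ord0 - c) (x - c) = 0.
    exact: (orth i j _ _ ij (wU i ord0) Hx).
  by rewrite (edotBl (x - c)) !(edotBr _ (x - c)) (edotC (x - c) (w _ _ - _)) H0
    subr0 sub0r opprK.
have qE i : q i = l ^+ 2 / 2.
  have [j ji _] := third_index i i r3; have [m mi mj] := third_index i j r3.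
  have E1 : q j + q i = l ^+ 2 by apply: pyth => //; [rewrite eq_sym | exact: dist].
  have E2 : q m + q i = l ^+ 2 by apply: pyth => //; [rewrite eq_sym | exact: dist].
  have E3 : q m + q j = l ^+ 2 by apply: pyth => //; [rewrite eq_sym | exact: dist].
  lra.
exists c, (Num.sqrt (l ^+ 2 / 2)), U; split=> //.
  by rewrite sqrtr_gt0 divr_gt0 // exprn_gt0.
move=> j x Hx; have xU := inU j x Hx; split=> //.
have [i ij] := other j; have := pyth i j x ij xU (Hx i ord0 ij).
by rewrite qE /edist => H; congr Num.sqrt; lra.
Qed.

Lemma circle_of_plane (R : realType) (d : nat) (c : 'rV[R]_d) (g : R)
    (U : {vspace 'rV[R]_d}) : 0 < g -> \dim U = 2%N ->
  is_circle [set x | affine_subspace c U x /\ edist x c = g] c g.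
Proof.
move=> g0 dU; split=> //; exists c, U; split=> //.
by rewrite /affine_subspace /= subrr mem0v.
Qed.

Lemma circles_of_orthogonal_planes (R : realType) (d : nat) (c : 'rV[R]_d)
    (g : R) (U U' : {vspace 'rV[R]_d}) :
  (forall u v, u \in U -> v \in U' -> edot u v = 0) ->
  circle_orthogonal [set x | affine_subspace c U x /\ edist x c = g]
                    [set x | affine_subspace c U' x /\ edist x c = g].
Proof.
move=> orth u v [x [y [Hx Hy ->]]] [x' [y' [Hx' Hy' ->]]].
have dir (T : {vspace 'rV[R]_d}) z z' :
    affine_span [set x | affine_subspace c T x /\ edist x c = g] z ->
    affine_span [set x | affine_subspace c T x /\ edist x c = g] z' ->
    z - z' \in T.
  move=> Hz Hz'.
  have zc : z - c \in T by apply: Hz => t [].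
  have z'c : z' - c \in T by apply: Hz' => t [].
  by have := memvB zc z'c; rewrite opprB addrA subrK.
by apply: orth; exact: dir.
Qed.

(** * Simplices and regular tuples *)

Lemma card_fset_filter (K : choiceType) (X : {fset K}) (P : pred K) :
  #|` [fset x in X | P x]| = #|[pred v : X | P (val v)]|.
Proof.
have -> : [fset x in X | P x] = [fset val v | v in [pred v : X | P (val v)]].
  apply/fsetP => x; rewrite !inE; apply/andP/imfsetP => [[xX Px]|[v /= Pv ->]].
    by exists [` xX].
  by split; first exact: valP.
by rewrite card_imfset /= -?cardE //; exact: val_inj.
Qed.

Definition regular_set (R : realType) (V : finType) (col : V -> V -> R) (k : nat)
    (A : {set V}) : bool :=
  (#|A| == k) &&
  `[< exists l, {in A &, forall x y, x != y -> col x y = l} >].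

Lemma card_simplices_sets (R : realType) (d k : nat) (X : {fset 'rV[R]_d}) :
  #|` simplices k X| =
  #|[pred A : {set X} | regular_set (fun x y : X => edist (val x) (val y)) k A]|.
Proof.
pose g (A : {set X}) : {fset 'rV[R]_d} := [fsetval x in A].
have gE (A : {set X}) (x : X) : (val x \in g A) = (x \in A).
  apply/imfsetP/idP => [[y /= yA /val_inj ->] //|xA].
  by exists x.
have ginj : injective g.
  by move=> A B E; apply/setP => x; rewrite -!gE E.
have gX A : (g A `<=` X)%fset.
  by apply/fsubsetP => x /imfsetP[y _ ->]; exact: valP.
pose P := [pred A : {set X} |
  regular_set (fun x y : X => edist (val x) (val y)) k A].
suff -> : simplices k X = [fset g A | A in P].
  by rewrite card_imfset /= -?cardE.
have cardg A : #|` g A| = #|A|.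
  by rewrite card_imfset /= -?cardE //; exact: val_inj.
have regg A : (exists l, {in g A &, forall x y, x != y -> edist x y = l}) <->
    (exists l, {in A &, forall x y : X, x != y -> edist (val x) (val y) = l}).
  split=> -[l H]; exists l => x y.
    by move=> xA yA xy; apply: H; rewrite ?gE // (inj_eq val_inj).
  move=> /imfsetP[x' /= xA ->] /imfsetP[y' /= yA ->] xy.
  by apply: H => //; apply: contra_neq xy => ->.
apply/fsetP => S; apply/idP/imfsetP => [|[A PA ->]].
  rewrite !inE /= fpowersetE => /andP[/fsubsetP SX /asboolP[Sk Sreg]].
  have gS : g [set x : X | val x \in S]%SET = S.
    apply/fsetP => x; apply/idP/idP => [/imfsetP[y /= + ->]|xS].
      by rewrite inE.
    by rewrite -[x]/(val [` SX _ xS]) gE inE.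
  exists [set x : X | val x \in S]%SET => //=.
  by rewrite inE /= /regular_set -cardg gS Sk eqxx; apply/asboolP/regg; rewrite gS.
move: PA; rewrite !inE /= fpowersetE gX => /andP[/eqP Ak /asboolP Areg].
by apply/asboolP; split; [rewrite cardg | apply/regg].
Qed.

Lemma card_regular_tuples (R : realType) (V : finType) (col : V -> V -> R)
    (k : nat) :
  #|[pred f : {ffun 'I_k -> V} | regular col f]| =
  (k`! * #|[pred A | regular_set col k A]|)%N.
Proof.
rewrite mulnC -sum_nat_const card_pred_sum.
rewrite (eq_bigr (fun f : {ffun 'I_k -> V} => \sum_(A | regular_set col k A)
    (injectiveb f && (f \in ffun_on (mem A))))%N); last first.
  move=> f _; pose B : {set V} := [set f x | x in 'I_k]%SET.
  have finB i : f i \in B by apply: imset_f.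
  have BE (A : {set V}) : injective f -> #|A| = k -> f \in ffun_on (mem A) -> A = B.
    move=> finj Ak /ffun_onP fA; apply/esym/eqP; rewrite eqEcard Ak.
    rewrite card_imset // card_ord leqnn andbT.
    by apply/fintype.subsetP => x /imsetP[i _ ->].
  case: (boolP (regular col f)) => [/regularP[finj reg]|nreg] /=.
    have Bk : #|B| = k by rewrite card_imset // card_ord.
    have regB : regular_set col k B.
      rewrite /regular_set Bk eqxx; apply/asboolP.
      have [k2|k1] := ltnP 1 k.
        pose i0 := Ordinal (ltnW k2); pose i1 := Ordinal k2.
        exists (col (f i0) (f i1)) => x y /imsetP[i _ ->] /imsetP[j _ ->] ij.
        by apply: reg => //; apply: contra_neq ij => ->.
      exists 0 => x y /imsetP[i _ ->] /imsetP[j _ ->]; rewrite (inj_eq finj).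
      by rewrite -val_eqE /=; have := ltn_ord i; have := ltn_ord j; lia.
    rewrite (bigD1 B) //= big1 => [|A /andP[/andP[/eqP Ak _] AB]].
      by rewrite addn0 (introT (injectiveP f) finj) /= (introT ffun_onP).
    case: (boolP (f \in _)) => [fA|]; last by rewrite andbF.
    by rewrite (BE A) ?eqxx in AB.
  rewrite big1 // => A /andP[/eqP Ak /asboolP[l Al]].
  apply/eqP; rewrite eqb0; apply: contra nreg => /andP[/injectiveP finj /ffun_onP fA].
  apply/regularP; split=> // i j i' j' ij ij'.
  by rewrite !Al ?(inj_eq finj) //; exact: fA.
rewrite exchange_big /=; apply: eq_bigr => A /andP[/eqP Ak _].
rewrite -card_pred_sum; have := card_inj_ffuns_on 'I_k (mem A).
rewrite card_ord Ak ffactnn => <-.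
by apply: eq_card => f; rewrite !inE andbC.
Qed.

(** * The Lenz configuration *)

(** Rational points of the unit circle in the r coordinate planes; the
    residue of m modulo r selects the plane. *)
Definition lenz_point (R : realType) (r m : nat) : 'rV[R]_(2 * r) :=
  let t := (m %/ r)%:R in
  \row_(s < 2 * r)
    (if s./2 != (m %% r)%N then 0
     else if odd s then 2 * t / (1 + t ^+ 2) else (1 - t ^+ 2) / (1 + t ^+ 2)).

Section Lenz.
Variables (R : realType) (r : nat).
Hypothesis r_gt0 : (0 < r)%N.

Let t_ (m : nat) : R := (m %/ r)%:R.

Lemma one_plus_sqr_gt0 (t : R) : 0 < 1 + t ^+ 2.
Proof. by rewrite ltr_pwDl // sqr_ge0. Qed.

Lemma lenz_even_bound m : (2 * (m %% r) < 2 * r)%N.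
Proof. by rewrite ltn_pmul2l // ltn_mod. Qed.

Lemma lenz_odd_bound m : ((2 * (m %% r)).+1 < 2 * r)%N.
Proof. by have := ltn_mod m r; rewrite r_gt0; lia. Qed.

Lemma lenz_pointE m m' :
  (lenz_point R r m' 0 (Ordinal (lenz_even_bound m)) =
     if (m %% r != m' %% r)%N then 0 else (1 - t_ m' ^+ 2) / (1 + t_ m' ^+ 2)) /\
  (lenz_point R r m' 0 (Ordinal (lenz_odd_bound m)) =
     if (m %% r != m' %% r)%N then 0 else 2 * t_ m' / (1 + t_ m' ^+ 2)).
Proof.
rewrite !mxE /= mul2n uphalf_double doubleK odd_double.
by split.
Qed.

Lemma edot_lenz_point m v :
  edot (lenz_point R r m) v =
  (1 - t_ m ^+ 2) / (1 + t_ m ^+ 2) * v 0 (Ordinal (lenz_even_bound m)) +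
  2 * t_ m / (1 + t_ m ^+ 2) * v 0 (Ordinal (lenz_odd_bound m)).
Proof.
have [E O] := lenz_pointE m m; rewrite eqxx /= in E O.
rewrite /edot (bigD1 (Ordinal (lenz_even_bound m))) //= E.
rewrite (bigD1 (Ordinal (lenz_odd_bound m))) //=; last by rewrite -val_eqE /=; lia.
rewrite O big1 ?addr0 // => s; rewrite -!val_eqE /= => /andP[s0 s1].
rewrite mxE; case: ifP => [_|/negbFE/eqP H]; first by rewrite mul0r.
by exfalso; move: s0 s1; rewrite -H; have := odd_double_half s; case: odd; lia.
Qed.

Lemma edot_lenz_same m : edot (lenz_point R r m) (lenz_point R r m) = 1.
Proof.
rewrite edot_lenz_point; have [-> ->] := lenz_pointE m m; rewrite eqxx /=.
by field; rewrite gt_eqF // one_plus_sqr_gt0.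
Qed.

Lemma edot_lenz_other m m' : (m %% r != m' %% r)%N ->
  edot (lenz_point R r m) (lenz_point R r m') = 0.
Proof.
move=> H; rewrite edot_lenz_point; have [-> ->] := lenz_pointE m m'.
by rewrite H !mulr0 addr0.
Qed.

Lemma lenz_point_inj : injective (lenz_point R r).
Proof.
move=> m m' E; have [mm'|nmm'] := eqVneq (m %% r)%N (m' %% r)%N; last first.
  have := edot_lenz_same m; rewrite {2}E edot_lenz_other // => /eqP.
  by rewrite eq_sym oner_eq0.
have [x y] := lenz_pointE m m; have [x' y'] := lenz_pointE m m'.
rewrite E x' mm' eqxx /= in x; rewrite E y' mm' eqxx /= in y.
have p := one_plus_sqr_gt0 (t_ m); have p' := one_plus_sqr_gt0 (t_ m').
have half t : 0 < 1 + t ^+ 2 -> (1 - t ^+ 2) / (1 + t ^+ 2) = 2 / (1 + t ^+ 2) - 1 :> R.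
  by move=> t0; field; rewrite gt_eqF.
rewrite !half // in x; have {}x : 2 / (1 + t_ m' ^+ 2) = 2 / (1 + t_ m ^+ 2).
  by move/addIr: x.
have n0 : 2 / (1 + t_ m ^+ 2) != 0 by rewrite gt_eqF // divr_gt0.
have : t_ m' = t_ m.
  by apply: (mulIf n0); rewrite -{1}x mulrCA mulrA y mulrCA mulrA.
move/eqP; rewrite eqr_nat => /eqP q.
by rewrite (divn_eq m r) (divn_eq m' r) mm' q.
Qed.

Lemma edist_lenz_other m m' : (m %% r != m' %% r)%N ->
  edist (lenz_point R r m) (lenz_point R r m') = Num.sqrt 2.
Proof.
move=> H; rewrite /edist; congr Num.sqrt.
rewrite !(edotBl, edotBr) !edot_lenz_same !edot_lenz_other // 1?eq_sym //.
by rewrite !subr0 sub0r opprK.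
Qed.

(** Tuples of points in different planes, all at distance sqrt 2. *)
Lemma lenz_configuration (k n : nat) :
  exists2 Y : {fset 'rV[R]_(2 * r)}, #|` Y| = n &
    (r ^_ k * (n %/ r) ^ k <= k`! * #|` simplices k Y|)%N.
Proof.
pose Y := [fset lenz_point R r (val m) | m in 'I_n].
have cardY : #|` Y| = n.
  rewrite card_imfset /= -?cardE ?card_ord // => m m' /lenz_point_inj.
  exact: val_inj.
exists Y => //; rewrite card_simplices_sets -card_regular_tuples.
set q := (n %/ r)%N.
have idx (s : 'I_r) (t : 'I_q) : (t * r + s < n)%N.
  apply: (@leq_trans (t.+1 * r)%N); first by rewrite mulSn addnC ltn_add2r.
  apply: leq_trans (leq_divM n r); rewrite leq_mul2r; apply/orP; right.
  exact: ltn_ord.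
have inY (s : 'I_r) (t : 'I_q) : lenz_point R r (t * r + s)%N \in Y.
  by apply/imfsetP; exists (Ordinal (idx s t)).
pose e (p : {ffun 'I_k -> 'I_r} * {ffun 'I_k -> 'I_q}) : {ffun 'I_k -> Y} :=
  [ffun i => [` inY (p.1 i) (p.2 i)]].
have einj : injective e.
  move=> [s t] [s' t'] /ffunP E.
  have H i : (t i * r + s i = t' i * r + s' i)%N.
    by have := congr1 val (E i); rewrite !ffunE /= => /lenz_point_inj.
  congr (_, _); apply/ffunP => i; apply/val_inj => /=.
    by have := congr1 (modn^~ r) (H i); rewrite /= !modnMDl !modn_small.
  have := congr1 (divn^~ r) (H i).
  by rewrite /= !divnMDl // !divn_small // !addn0.
have <- : #|[predX [pred s : {ffun 'I_k -> 'I_r} | injectiveb s] &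
              [pred t : {ffun 'I_k -> 'I_q} | true]]| = (r ^_ k * q ^ k)%N.
  rewrite cardX; congr (_ * _)%N.
    rewrite -[in RHS](card_ord r) -[in RHS](card_ord k) -card_inj_ffuns.
    by apply: eq_card => s; rewrite !inE.
  by rewrite -[in RHS](card_ord q) -[in RHS](card_ord k) -card_ffun; exact: eq_card.
rewrite -(fintype.card_image einj); apply/subset_leq_card/fintype.subsetP => f.
case/fintype.imageP => -[s t]; rewrite !inE /= andbT => /injectiveP sinj ->.
have dist i j : i != j -> edist (val (e (s, t) i)) (val (e (s, t) j)) = Num.sqrt 2.
  move=> ij; rewrite !ffunE /=; apply: edist_lenz_other.
  by rewrite !modnMDl !modn_small // (inj_eq val_inj) (inj_eq sinj).
apply/regularP; split=> [i j E|i j i' j' ij ij']; last by rewrite !dist.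
apply/eqP/negPn/negP => /dist; rewrite E /edist subrr edot0l sqrtr0.
by move/eqP; rewrite eq_sym gt_eqF // sqrtr_gt0.
Qed.

End Lenz.

Lemma ffact_turan (R : realType) (r k : nat) : (0 < r)%N -> (k <= r)%N ->
  (r ^_ k)%:R = turan R r k * r%:R ^+ k.
Proof.
move=> r0; elim: k => [|k IH] kr; first by rewrite /turan big_ord0 mul1r.
rewrite ffactnSr natrM IH ?(ltnW kr) // turanS exprSr natrB ?(ltnW kr) //.
by field; rewrite pnatr_eq0 -lt0n.
Qed.

Lemma bernoulli (R : realType) (x : R) (k : nat) : 0 <= x <= 1 ->
  1 - k%:R * x <= (1 - x) ^+ k.
Proof.
move=> /andP[x0 x1]; elim: k => [|k IH]; first by rewrite mul0r subr0.
rewrite exprSr -natr1; have : 0 <= k%:R * x * x by rewrite !mulr_ge0.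
have : 0 <= (1 - x) * ((1 - x) ^+ k - (1 - k%:R * x)).
  by rewrite mulr_ge0 ?subr_ge0.
nra.
Qed.

Lemma max_simplices_lower_bound (R : realType) (r k : nat) (g : R) :
  (0 < r)%N -> (k <= r)%N -> 0 < g ->
  exists n0 : nat, forall n, (n0 <= n)%N ->
    (turan R r k - g) * n%:R ^+ k <= k`!%:R * (max_simplices R (2 * r) k n)%:R.
Proof.
move=> r0 kr g0; have r0' : 0 < r%:R :> R by rewrite ltr0n.
pose N := (Num.truncn (k%:R * r%:R / g)).+1.
exists (maxn N r) => n; rewrite geq_max => /andP[nN rn].
have n0 : 0 < n%:R :> R by rewrite ltr0n; exact: leq_trans rn.
have [Y Yn HY] := lenz_configuration R r0 k n.
have := max_simplices_ge k Y; rewrite Yn -(ler_nat R) => le_max.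
apply: (@le_trans _ _ (k`! * #|` simplices k Y|)%:R); last first.
  by rewrite natrM ler_wpM2l.
apply: le_trans (_ : (r ^_ k * (n %/ r) ^ k)%:R <= _); last by rewrite ler_nat.
rewrite natrM natrX ffact_turan // -mulrA -exprMn.
have x01 : 0 <= (r%:R / n%:R : R) <= 1.
  by rewrite divr_ge0 //= ler_pdivrMr // mul1r ler_nat.
have floor : (1 - r%:R / n%:R) * n%:R <= r%:R * (n %/ r)%:R :> R.
  rewrite mulrBl mul1r divfK ?gt_eqF // lerBlDr -natrM -natrD ler_nat.
  by rewrite {1}(divn_eq n r) mulnC leq_add2l ltnW // ltn_mod.
have T0 := turan_ge0 R r0 kr; have T1 := turan_le1 R r0 kr.
apply: (@le_trans _ _ (turan R r k * ((1 - r%:R / n%:R) * n%:R) ^+ k)).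
  rewrite exprMn mulrA ler_wpM2r ?exprn_ge0 //.
  have : turan R r k * (1 - k%:R * (r%:R / n%:R)) <=
         turan R r k * (1 - r%:R / n%:R) ^+ k by rewrite ler_wpM2l // bernoulli.
  have kn : k%:R * (r%:R / n%:R) <= g.
    rewrite mulrA ler_pdivrMr // [g * _]mulrC -ler_pdivrMr // ltW //.
    by apply: lt_le_trans (truncnS_gt _) _; rewrite ler_nat.
  have : turan R r k * (k%:R * (r%:R / n%:R)) <= k%:R * (r%:R / n%:R).
    by rewrite ler_piMl // mulr_ge0 //; case/andP: x01.
  lra.
rewrite ler_wpM2l // lerXn2r ?nnegrE ?mulr_ge0 //.
by rewrite subr_ge0; case/andP: x01.
Qed.

(** * Stability *)

(** The Lenz configuration turns the hypothesis into a lower bound for the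
    number of regular k-tuples; the dimension enters the combinatorial part
    only through the absence of a box with r + 1 parts. *)
Lemma near_extremal_boxes (R : realType) (r k : nat) (eta : R) :
  (3 <= k)%N -> (k <= r)%N -> 0 < eta ->
  exists (delta : R) (n0 : nat), 0 < delta /\
    forall X : {fset 'rV[R]_(2 * r)}, (n0 <= #|` X|)%N ->
      (max_simplices R (2 * r) k #|` X|)%:R - delta * #|` X|%:R ^+ k
        <= #|` simplices k X|%:R ->
      exists (w : 'I_r -> 'I_3 -> 'rV[R]_(2 * r)) (l : R),
        [/\ forall i, injective (w i), 0 < l,
            forall i j a b, i != j -> edist (w i a) (w j b) = l &
            forall j, (r%:R^-1 - eta) * #|` X|%:R <=
              #|[pred v : X | [forall i, forall a,
                   (i != j) ==> (edist (val v) (w i a) == l)]]|%:R].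
Proof.
move=> k3 kr eta0.
have r3 : (3 <= r)%N by apply: leq_trans kr.
have r0 : (0 < r)%N by apply: leq_trans r3.
have [g g0 [n1 Hn1]] := combinatorial_stability k3 kr eta0.
have g20 : 0 < g / 2 by rewrite divr_gt0.
have [n2 Hn2] := max_simplices_lower_bound r0 kr g20.
have f0 : 0 < k`!%:R :> R by rewrite ltr0n fact_gt0.
exists (g / 2 / k`!%:R), (maxn n1 n2); split; first by rewrite divr_gt0.
move=> X; rewrite geq_max => /andP[Xn1 Xn2] HX.
pose col (x y : X) := edist (val x) (val y).
have colC x y : col x y = col y x by exact: edistC.
have XE : #|{: X}| = #|` X| by rewrite cardfE.
have := Hn1 X col colC; rewrite XE => /(_ Xn1 (no_large_box r0)) [].
  rewrite card_regular_tuples -card_simplices_sets natrM.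
  apply: le_trans (_ : _ <= k`!%:R * ((max_simplices R (2 * r) k #|` X|)%:R
     - g / 2 / k`!%:R * #|` X|%:R ^+ k)) _; last by rewrite ler_wpM2l // ltW.
  rewrite mulrBr mulrA mulrCA divff ?gt_eqF // mulr1.
  have := Hn2 _ Xn2; rewrite !mulrBl; lra.
move=> W [l [Winj Hl Hpart]].
exists (fun i a => val (W i a)), l; split=> [i a b /val_inj/Winj //| |i j a b ij|].
- have [i ij _] := third_index (Ordinal r0) (Ordinal r0) r3.
  have [ne <-] := Hl i (Ordinal r0) ord0 ord0 ij.
  by apply: edist_gt0; rewrite (inj_eq val_inj).
- by have [_] := Hl i j a b ij.
exact: Hpart.
Qed.

Unset Implicit Arguments.
Set Strict Implicit.

Theorem theorem7 (R : realType) (r k : nat) (hk : (3 <= k)%N)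
    (hr : (k <= r)%N) (eps : R) (heps : 0 < eps) :
  exists (delta : R) (n0 : nat), 0 < delta /\
    forall (n : nat) (X : {fset 'rV[R]_(2 * r)}),
      (n0 <= n)%N -> #|` X| = n ->
      (max_simplices R (2 * r) k n)%:R - delta * n%:R ^+ k
        <= (#|` simplices k X|)%:R :> R ->
      exists (A0 : {fset 'rV[R]_(2 * r)})
             (A : 'I_r -> {fset 'rV[R]_(2 * r)}),
        [/\ X = (A0 `|` \big[fsetU/fset0]_(i < r) A i)%fset,
            forall i : 'I_r, fdisjoint A0 (A i),
            forall i j : 'I_r, i != j -> fdisjoint (A i) (A j),
            (#|` A0|)%:R <= eps * n%:R &
            forall i : 'I_r,
              `| (#|` A i|)%:R - n%:R / r%:R | <= eps * n%:R] /\
        exists (C : 'I_r -> set 'rV[R]_(2 * r))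
               (c : 'I_r -> 'rV[R]_(2 * r)) (g : 'I_r -> R),
          [/\ forall i : 'I_r, is_circle (C i) (c i) (g i),
              forall i j : 'I_r, i != j -> circle_orthogonal (C i) (C j),
              forall i : 'I_r, [set` A i] `<=` C i &
              forall i j : 'I_r, c i = c j /\ g i = g j].
Proof.
have r3 : (3 <= r)%N by apply: leq_trans hr.
have r0 : 0 < r%:R :> R by rewrite ltr0n; apply: leq_trans r3.
(* the lower bounds for the r parts together lose r times this *)
have eta0 : 0 < eps / r%:R by rewrite divr_gt0.
have [delta [n0 [delta0 Hstab]]] := near_extremal_boxes hk hr eta0.
exists delta, n0; split=> // n X nn0 Xn HX; rewrite -Xn in nn0 HX.
have [w [l [winj l0 Hw Hpart]]] := Hstab X nn0 HX; rewrite Xn in Hpart.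
have [c [g [U [g0 dimU orth Hcirc]]]] := box_circles r3 winj l0 Hw.
pose C i : set 'rV[R]_(2 * r) :=
  [set x | affine_subspace c (U i) x /\ edist x c = g].
pose P i x := `[< C i x >].
pose A i := [fset x in X | P i x].
pose A0 := [fset x in X | ~~ [exists i, P i x]].
have disj i j x : i != j -> P i x -> P j x -> False.
  move=> ij /asboolP[xi xg] /asboolP[xj _].
  have := edist_sqr x c; rewrite (orth i j _ _ ij xi xj) xg => /eqP.
  by rewrite expf_eq0 gt_eqF.
have part_ge i : (r%:R^-1 - eps / r%:R) * n%:R <= #|` A i|%:R.
  apply: le_trans (Hpart i) _; rewrite ler_nat card_fset_filter.
  apply/subset_leq_card/fintype.subsetP => v; rewrite !inE => /forallP Hv.
  apply: Hcirc => j a ji.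
  by have /forallP/(_ a)/implyP/(_ ji)/eqP := Hv j.
have total : (#|` A0| + \sum_i #|` A i| = n)%N.
  rewrite -Xn [RHS]cardfE -sum1_card card_fset_filter card_pred_sum.
  rewrite (eq_bigr _ (fun i _ => card_fset_filter X (P i))).
  rewrite (eq_bigr _ (fun i _ => card_pred_sum _)) exchange_big -big_split /=.
  apply: eq_bigr => v _; case: (boolP [exists i, P i (val v)]) => [|nP] /=.
    case/existsP=> i Pi; rewrite (bigD1 i) //= Pi big1 // => j ji.
    by apply/eqP; rewrite eqb0; apply/negP => Pj; exact: disj ji Pj Pi.
  rewrite big1 // => i _; apply/eqP; rewrite eqb0.
  by move: nP; rewrite negb_exists => /forallP/(_ i).
have totalR : #|` A0|%:R + \sum_i #|` A i|%:R = n%:R :> R.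
  by rewrite -natr_sum -natrD total.
have rr : r%:R * (eps / r%:R) = eps by rewrite mulrC divfK // gt_eqF.
have sum_low (Q : pred 'I_r) :
    #|Q|%:R * ((r%:R^-1 - eps / r%:R) * n%:R) <= \sum_(i | Q i) #|` A i|%:R.
  rewrite mulr_natl -sumr_const.
  by apply: ler_sum => i _; exact: part_ge.
have A0_ge : 0 <= #|` A0|%:R :> R by [].
exists A0, A; split; last first.
  exists C, (fun=> c), (fun=> g); split=> // [i|i j ij|i x /=].
  - exact: circle_of_plane.
  - by apply: circles_of_orthogonal_planes => u v; exact: orth.
  - by rewrite !inE => /andP[_ /asboolP].
split.
- apply/fsetP => x; rewrite !inE; apply/idP/orP => [xX|[/andP[] //|]].
    case: (boolP [exists i, P i x]) => [/existsP[i Pi]|nP]; last first.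
      by left; rewrite xX.
    by right; apply/bigfcupP; exists i; rewrite ?mem_index_enum // !inE xX.
  by case/bigfcupP=> i _; rewrite !inE => /andP[].
- move=> i; apply/fdisjointP => x; rewrite !inE => /andP[xX nP].
  rewrite xX /=; apply: contra nP => Pi; apply/existsP; by exists i.
- move=> i j ij; apply/fdisjointP => x; rewrite !inE => /andP[xX Pi].
  by rewrite xX /=; apply/negP => Pj; exact: disj ij Pi Pj.
- have := sum_low xpredT; rewrite card_ord mulrA mulrBr divff ?gt_eqF // rr.
  by rewrite mulrBl mul1r; lra.
(* the lower bounds for the other parts leave little more than n / r points *)
move=> i; have low := part_ge i; have := sum_low (predC1 i).
have -> : #|predC1 i|%:R = r%:R - 1 :> R.
  have := cardC1 i; rewrite card_ord => ->.
  by rewrite -subn1 natrB // (leq_trans _ r3).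
move: totalR; rewrite (bigD1 i) //= => totalR rest.
have E : (r%:R - 1) * ((r%:R^-1 - eps / r%:R) * n%:R) =
    n%:R - eps * n%:R - (r%:R^-1 - eps / r%:R) * n%:R.
  by field; rewrite gt_eqF.
have le_eps : eps / r%:R * n%:R <= eps * n%:R.
  rewrite ler_wpM2r // ler_pdivrMr // ler_peMr ?ler1n //; first exact: ltW.
  exact: leq_trans r3.
rewrite E in rest; rewrite mulrBl in low rest; have nr : n%:R / r%:R = r%:R^-1 * n%:R :> R by rewrite mulrC.
have le0 : 0 <= eps / r%:R * n%:R by rewrite mulr_ge0 // ltW.
rewrite ler_norml nr; apply/andP; split; first lra.
lra.
Qed.
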